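(* Let $0\le k\le n$. Then $$\mathrm{Hom}_{\mathrm{QSym}_n}(\mathrm{Pol}_n,\mathrm{Pol}_{n-k})=\bigoplus_{H\in\mathsf{For}_n,\ |H|\le k}\mathrm{Pol}_{n-k}\,\mathsf{R}_1^{\,k-|H|}\,\mathsf{T}_H,$$ i.e. each $\mathsf{R}_1^{k-|H|}\mathsf{T}_H$ (restricted to $\mathrm{Pol}_n$) is a $\mathrm{QSym}_n$-module homomorphism $\mathrm{Pol}_n\to\mathrm{Pol}_{n-k}$, and these homomorphisms, for $H\in\mathsf{For}_n$ with $|H|\le k$, form a basis of $\mathrm{Hom}_{\mathrm{QSym}_n}(\mathrm{Pol}_n,\mathrm{Pol}_{n-k})$ as a $\mathrm{Pol}_{n-k}$-module (acting by multiplication on the target).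
   Context: $\mathrm{Pol}=\mathbb{Z}[x_1,x_2,\ldots]$, $\mathrm{Pol}_n=\mathbb{Z}[x_1,\ldots,x_n]$ ($\mathrm{Pol}_0=\mathbb{Z}$). $\mathrm{QSym}_n\subset \mathrm{Pol}_n$ is the ring of polynomials such that for every sequence $a_1,\ldots,a_k\ge 1$ the coefficients of $x_{i_1}^{a_1}\cdots x_{i_k}^{a_k}$ and $x_{j_1}^{a_1}\cdots x_{j_k}^{a_k}$ are equal whenever $1\le i_1<\cdots<i_k\le n$ and $1\le j_1<\cdots<j_k\le n$. For $i\ge 1$, $\mathsf{R}_i(f)=f(x_1,\ldots,x_{i-1},0,x_i,x_{i+1},\ldots)$ and $\mathsf{T}_i(f)=\frac{\mathsf{R}_{i+1}(f)-\mathsf{R}_i(f)}{x_i}$ for $f\in\mathrm{Pol}$. $\mathrm{Pol}_n$ is a $\mathrm{QSym}_n$-module by multiplication, and $\mathrm{Pol}_{n-k}$ is regarded as a $\mathrm{QSym}_n$-module via the ring map $\mathsf{R}_1^k|_{\mathrm{QSym}_n}:\mathrm{QSym}_n\to\mathrm{QSym}_{n-k}$; that is, $\Phi\in \mathrm{Hom}_{\mathrm{QSym}_n}(\mathrm{Pol}_n,\mathrm{Pol}_{n-k})$ means $\Phi$ is additive and $\Phi(gf)=\mathsf{R}_1^k(g)\Phi(f)$ for $g\in\mathrm{QSym}_n$, $f\in\mathrm{Pol}_n$. Forests: a binary tree is a finite rooted plane tree in which each node is either a leaf (no children) or internal, having an ordered pair of children; $\ast$ is the tree with a single node (a leaf).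 An indexed forest is an infinite sequence $F=(T_1,T_2,\ldots)$ of binary trees, all but finitely many equal to $\ast$; $\mathsf{For}$ is the set of indexed forests, and $\varnothing$ is the forest all of whose trees are $\ast$. The leaves of $F$, read from left to right, are identified with $1,2,3,\ldots$. $|F|$ is the number of internal nodes of $F$. $\mathrm{supp}(F)$ is the set of leaves of the trees of $F$ different from $\ast$, and $\mathsf{For}_n=\{F\in\mathsf{For}:\mathrm{supp}(F)\subset\{1,\ldots,n\}\}$. The product $F\cdot G$ is obtained by identifying, for each $i$, the $i$-th leaf of $F$ with the root of the $i$-th tree of $G$; this is a monoid structure with identity $\varnothing$. $\underline{i}$ is the forest whose only nontrivial tree is its $i$-th tree, which has exactly one internal node; these generate $\mathsf{For}$. For $F\in\mathsf{For}$, $\mathsf{T}_F=\mathsf{T}_{i_1}\cdots\mathsf{T}_{i_k}$ (composition) for any expression $F=\underline{i_1}\cdots\underline{i_k}$; this is independent of the expression, and $\mathsf{T}_\varnothing=\mathrm{id}$. *)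

(* Defs.v *)
From HB Require Import structures.
From mathcomp Require Import all_boot all_order all_algebra finmap.
From mathcomp.multinomials Require Import monalg.

Set Implicit Arguments.
Unset Strict Implicit.
Unset Printing Implicit Defensive.

Import GRing.Theory.
Local Open Scope ring_scope.

(* Everything is indexed from 0: the variable x_(i+1) is [varX i], R_(i+1) is
   [opR i], T_(i+1) is [opT i], and the trees of a forest, as well as its
   leaves, are numbered 0, 1, 2, ... *)

Notation Pol := {malg int[{cmonom nat}]}.

Definition varX (i : nat) : Pol := << ucm i >>.

(* x_0, x_1, ... |-> x_0, ..., x_(i-1), 0, x_i, x_(i+1), ... *)
Definition R_var (i j : nat) : Pol :=
  if (j < i)%N then varX j else if j == i then 0 else varX j.-1.

Definition R_mon (i : nat) (m : {cmonom nat}) : Pol :=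
  \prod_(j <- finsupp m) R_var i j ^+ m j.

Lemma R_monEw i (d : {fset nat}) (m : {cmonom nat}) :
  (finsupp m `<=` d)%fset -> R_mon i m = \prod_(j <- d) R_var i j ^+ m j.
Proof.
move=> le; rewrite /R_mon.
apply: big_fset_incl => //= j jd jm.
by rewrite fsfun_dflt // expr0.
Qed.

Lemma R_mon_mmorphism i : mmorphism (R_mon i).
Proof.
split.
- move=> m1 m2; pose d := finsupp (mmul m1 m2).
  have le1 : (finsupp m1 `<=` d)%fset by rewrite /d mdomD fsubsetUl.
  have le2 : (finsupp m2 `<=` d)%fset by rewrite /d mdomD fsubsetUr.
  rewrite (R_monEw _ le1) (R_monEw _ le2) /R_mon -big_split /=.
  by apply: eq_bigr => j _; rewrite cmM exprD.
- by rewrite /R_mon mdom1 big_seq_fset0.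
Qed.

HB.instance Definition _ i :=
  isMultiplicative.Build {cmonom nat} Pol (R_mon i) (R_mon_mmorphism i).

HB.lock Definition opR (i : nat) : Pol -> Pol :=
  mmap (@malgC {cmonom nat} int) (R_mon i).

Lemma opR_zmod_morphism i : zmod_morphism (opR i).
Proof. by rewrite opR.unlock; exact: rmorphB. Qed.

Lemma opR_monoid_morphism i : monoid_morphism (opR i).
Proof. by rewrite opR.unlock; split; [exact: rmorph1 | exact: rmorphM]. Qed.

HB.instance Definition _ i :=
  GRing.isZmodMorphism.Build Pol Pol (opR i) (opR_zmod_morphism i).
HB.instance Definition _ i :=
  GRing.isMonoidMorphism.Build Pol Pol (opR i) (opR_monoid_morphism i).

Lemma opR_C i c : opR i c%:MP = c%:MP.
Proof. by rewrite opR.unlock mmapC. Qed.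

Lemma opR_X i j : opR i (varX j) = R_var i j.
Proof.
rewrite opR.unlock mmapU /= mpolyC1E mul1r /R_mon mdomU big_seq_fset1.
by rewrite cmUU expr1.
Qed.

Definition divX (i : nat) (f : Pol) : Pol :=
  \sum_(m <- msupp f | m i != 0%N) << f@_m *g divcm m (ucm i) >>.

Definition opT (i : nat) (f : Pol) : Pol := divX i (opR i.+1 f - opR i f).

Lemma malgUM (m1 m2 : {cmonom nat}) : << m1 >> * << m2 >> = << mmul m1 m2 >> :> Pol.
Proof. by rewrite malgM_def fgmulUU mulr1. Qed.

Lemma cmonom_neq1 (m : {cmonom nat}) : m != mone -> exists j, m j != 0%N.
Proof.
rewrite -mdeg_eq0 mdegE => nz.
have [/fset0Pn[j jm]|/negPn/eqP e] := boolP (finsupp m != fset0).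
  by exists j; rewrite cmE_neq0.
by rewrite e big_seq_fset0 in nz.
Qed.

Lemma divcm_mulU (m : {cmonom nat}) j :
  m j != 0%N -> mmul (divcm m (ucm j)) (ucm j) = m.
Proof.
move=> mj; apply/eqP/cmP => l; rewrite cmM divcmE subnK // cmU.
by case: eqP => // <-; rewrite lt0n.
Qed.

Lemma divX_coef i f m : (divX i f)@_m = f@_(mmul m (ucm i)).
Proof.
have mm : divcm (mmul m (ucm i)) (ucm i) = m.
  by apply/eqP/cmP => j; rewrite divcmE cmM addnK.
have mi : mmul m (ucm i) i != 0%N by rewrite cmM cmUU addn1.
rewrite /divX raddf_sum /=.
have E (m' : {cmonom nat}) : m' i != 0%N ->
    << f@_m' *g divcm m' (ucm i) >>@_m = f@_m' *+ (m' == mmul m (ucm i)).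
  move=> m'i; rewrite mcoeffU; congr (_ *+ nat_of_bool _); apply/eqP/eqP=> [<-|-> //].
  by rewrite divcm_mulU.
rewrite (eq_bigr _ E).
have [iin|nin] := boolP ((mmul m (ucm i)) \in msupp f); last first.
  rewrite (mcoeff_outdom nin) big_seq_cond big1 // => m' /andP[m's _].
  by case: eqP => // e; rewrite -e m's in nin.
rewrite big_mkcond (bigD1_seq _ iin (fset_uniq _)) /= mi eqxx mulr1n.
by rewrite big1 ?addr0 // => m' /negPf->; rewrite mulr0n if_same.
Qed.

Lemma varX_mul_coef i g m : (varX i * g)@_(mmul m (ucm i)) = g@_m.
Proof.
rewrite mcoeffMl /varX msuppU1 big_seq_fset1 mcoeffUU.
have E (k : {cmonom nat}) :
   (1 * g@_k) *+ (mmul (ucm i) k == mmul m (ucm i)) = g@_k *+ (k == m).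
  rewrite mul1r mulmC; congr (_ *+ nat_of_bool _); apply/eqP/eqP=> [|-> //].
  move/eqP/cmP => e; apply/eqP/cmP => j; have := e j.
  by rewrite !cmM => /addIn.
rewrite (eq_bigr _ (fun k _ => E k)).
have [iin|nin] := boolP (m \in msupp g); last first.
  rewrite (mcoeff_outdom nin) big_seq_cond big1 // => m' /andP[m's _].
  by case: eqP => // e; rewrite -e m's in nin.
rewrite (bigD1_seq _ iin (fset_uniq _)) /= eqxx mulr1n.
by rewrite big1 ?addr0 // => m' /negPf->; rewrite mulr0n.
Qed.

Lemma divXK i g : divX i (varX i * g) = g.
Proof. by apply/malgP => m; rewrite divX_coef varX_mul_coef. Qed.

Lemma twisted_leibniz (S : comNzRingType) (a b c d x u v : S) :
  a - b = x * u -> c - d = x * v -> a * c - b * d = x * (a * v + u * d).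
Proof.
by move=> e1 e2; rewrite mulrDr mulrCA -e2 mulrA -e1 mulrBr mulrBl addrA subrK.
Qed.

Lemma opR_diff_dvd i f : exists g, opR i.+1 f - opR i f = varX i * g.
Proof.
pose D f := exists g, opR i.+1 f - opR i f = varX i * g.
have D0 : D 0 by exists 0; rewrite !rmorph0 subrr mulr0.
have DD f1 f2 : D f1 -> D f2 -> D (f1 + f2).
  case=> g1 e1 [g2 e2]; exists (g1 + g2).
  by rewrite !rmorphD /= mulrDr -e1 -e2 opprD addrACA.
have DM f1 f2 : D f1 -> D f2 -> D (f1 * f2).
  case=> g1 e1 [g2 e2]; exists (opR i.+1 f1 * g2 + g1 * opR i f2).
  rewrite (rmorphM (opR i.+1)) (rmorphM (opR i)).
  exact (@twisted_leibniz Pol _ _ _ _ _ _ _ e1 e2).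
have DC c : D c%:MP by exists 0; rewrite !opR_C subrr mulr0.
have DX j : D (varX j).
  rewrite /D !opR_X /R_var ltnS.
  case: ltngtP => [ji|ji|->].
  + by exists 0; rewrite subrr mulr0.
  + case: eqP => [->|_] /=; first by exists (-1); rewrite sub0r mulrN1.
    by exists 0; rewrite subrr mulr0.
  + by exists 1; rewrite mulr1 subr0.
have DU m : D << m >>.
  have [N] := ubnP (mdeg m); elim: N m => // N IH m ltN.
  have [->|/cmonom_neq1 [j mj]] := eqVneq m mone.
    exact: (DC 1).
  rewrite -(divcm_mulU mj) -malgUM; apply: DM; [apply: IH|exact: DX].
  by move: ltN; rewrite -{1}(divcm_mulU mj) mdegM mdegU addn1 ltnS.
suff : D f by [].
rewrite [f]monalgE; elim/big_rec: _ => [|m g _ Dg]; first exact: D0.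
apply: DD => //; have -> : << f@_m *g m >> = (f@_m)%:MP * << m >>.
  by rewrite malgM_def fgmulUU mulr1 mul1m.
exact: DM.
Qed.

Lemma opTE i f : varX i * opT i f = opR i.+1 f - opR i f.
Proof. by rewrite /opT; have [g ->] := opR_diff_dvd i f; rewrite divXK. Qed.

Definition inPol (n : nat) : {pred Pol} :=
  [pred f : Pol | all (fun m : {cmonom nat} => all (gtn n) (finsupp m)) (msupp f)].

Lemma inPolP n (f : Pol) :
  reflect (forall (m : {cmonom nat}) i, m \in msupp f -> m i != 0%N -> (i < n)%N)
          (f \in inPol n).
Proof.
apply: (iffP allP) => [H m i mf mi|H m mf].
  by apply: (allP (H m mf)); rewrite -cmE_neq0.
by apply/allP => i im; apply: (H m i mf); rewrite cmE_neq0.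
Qed.

Lemma inPol_subring n : subring_closed (inPol n).
Proof.
split.
- by apply/inPolP => m i; rewrite msuppU1 in_fset1 => /eqP->; rewrite cm1.
- move=> f g /inPolP Hf /inPolP Hg; apply/inPolP => m i.
  move/(fsubsetP (msuppB_le f g)); rewrite in_fsetU => /orP[]; [exact: Hf|exact: Hg].
- move=> f g /inPolP Hf /inPolP Hg; apply/inPolP => m i.
  move/msuppM_le => [m1 [m2 [m1f m2g ->]]]; rewrite cmM addn_eq0 negb_and.
  by case/orP; [exact: Hf|exact: Hg].
Qed.

HB.instance Definition _ n :=
  GRing.isSubringClosed.Build Pol (inPol n) (inPol_subring n).

Record PolN (n : nat) := MkPolN { polN_val :> Pol; _ : polN_val \in inPol n }.

HB.instance Definition _ n := [isSub for @polN_val n].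
HB.instance Definition _ n := [Choice of PolN n by <:].
HB.instance Definition _ n := [SubChoice_isSubComNzRing of PolN n by <:].

(* x_(s_1)^(a_1) ... x_(s_k)^(a_k) *)
Definition mon_of (s a : seq nat) : {cmonom nat} :=
  \big[mmul/mone]_(p <- zip s a) expcmn (ucm p.1) p.2.

Definition is_qsym (n : nat) (f : PolN n) : Prop :=
  forall a s t : seq nat, all (leq 1) a ->
    size s = size a -> sorted ltn s -> all (gtn n) s ->
    size t = size a -> sorted ltn t -> all (gtn n) t ->
    (f : Pol)@_(mon_of s a) = (f : Pol)@_(mon_of t a).

(* [PolN (n - k)] is a module over QSym_n through (R_1)^k. *)
Definition is_qsym_hom (n k : nat) (Phi : PolN n -> PolN (n - k)) : Prop :=
  {morph Phi : f g / f + g} /\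
  forall g f : PolN n, is_qsym g ->
    Phi (g * f) = iter k (opR 0) g * Phi f :> Pol.

Inductive btree : predArgType := Leaf | Node of btree & btree.

Fixpoint btree_encode (t : btree) : GenTree.tree unit :=
  match t with
  | Leaf => GenTree.Leaf tt
  | Node l r => GenTree.Node 0 [:: btree_encode l; btree_encode r]
  end.

Fixpoint btree_decode (t : GenTree.tree unit) : btree :=
  match t with
  | GenTree.Node _ [:: l; r] => Node (btree_decode l) (btree_decode r)
  | _ => Leaf
  end.

Lemma btree_encodeK : cancel btree_encode btree_decode.
Proof. by elim=> //= l -> r ->. Qed.

HB.instance Definition _ := Countable.copy btree (can_type btree_encodeK).

Fixpoint leaves (t : btree) : nat :=
  if t is Node l r then (leaves l + leaves r)%N else 1%N.

Fixpoint nodes (t : btree) : nat :=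
  if t is Node l r then (nodes l + nodes r).+1 else 0%N.

Notation forest := {fsfun nat -> btree with Leaf}.

(* The leaves of the i-th tree of F are numbered consecutively from here. *)
Definition first_leaf (F : forest) (i : nat) : nat :=
  (\sum_(j < i) leaves (F j))%N.

Definition forest_size (F : forest) : nat := (\sum_(i <- finsupp F) nodes (F i))%N.

Definition supp (F : forest) : seq nat :=
  flatten [seq iota (first_leaf F i) (leaves (F i)) | i <- finsupp F].

Definition For_ (n : nat) : {pred forest} := [pred F : forest | all (gtn n) (supp F)].

Definition forest0 : forest := [fsfun].

Definition cherry (i : nat) : forest := [fsfun forest0 with i |-> Node Leaf Leaf].

(* The leaves of t, read from left to right, receive G o, G o.+1, ... *)
Fixpoint graft (t : btree) (G : nat -> btree) (o : nat) : btree :=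
  if t is Node l r then Node (graft l G o) (graft r G (o + leaves l)) else G o.

(* The finite set below is only meant to be large enough, see [forest_mulE]. *)
Definition forest_mul (F G : forest) : forest :=
  [fsfun i in (finsupp F `|` [fset j in iota 0 (\max_(j <- finsupp G) j).+1])%fset
     => graft (F i) G (first_leaf F i)].

Lemma leaves_gt0 t : (0 < leaves t)%N.
Proof. by elim: t => //= l Hl r Hr; rewrite addn_gt0 Hl. Qed.

Lemma leq_first_leaf F i : (i <= first_leaf F i)%N.
Proof.
rewrite /first_leaf -[X in (X <= _)%N](card_ord i) -sum1_card.
by apply: leq_sum => j _; apply: leaves_gt0.
Qed.

Lemma in_fset_iota n i : (i \in [fset j in iota 0 n]%fset) = (i < n)%N.
Proof. by rewrite in_fset /= -[RHS](mem_iota 0 n i). Qed.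

Lemma forest_mulE F G i : forest_mul F G i = graft (F i) G (first_leaf F i).
Proof.
rewrite /forest_mul fsfun_fun in_fsetU.
case: (finsuppP F i) => [nF|//]; rewrite orFb.
case: ifPn => // nin; rewrite /= [RHS]fsfun_dflt //.
apply: contra nin => inG; rewrite in_fset_iota ltnS.
apply: leq_trans (leq_first_leaf F i) _.
exact: (@leq_bigmax_seq _ _ xpredT id).
Qed.

Definition forest_word (w : seq nat) : forest :=
  foldr (fun i F => forest_mul (cherry i) F) forest0 w.

Lemma forest_sizeEw (F : forest) N : (forall i, (N <= i)%N -> F i = Leaf) ->
  forest_size F = (\sum_(0 <= i < N) nodes (F i))%N.
Proof.
move=> hN; rewrite /forest_size [RHS](bigID (fun i => i \in finsupp F)) /=.
rewrite [X in (_ + X)%N]big1 ?addn0; last by move=> i /fsfun_dflt->.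
rewrite -[RHS]big_filter; apply: perm_big; apply: uniq_perm => [||i]; first exact: fset_uniq.
  by rewrite filter_uniq /index_iota ?iota_uniq.
rewrite mem_filter mem_index_iota /=; case: finsuppP => //= iF.
by rewrite ltnNge; apply/esym/negP => /hN e; rewrite mem_finsupp e eqxx in iF.
Qed.

Lemma forest_bound (F : forest) : exists N, forall i, (N <= i)%N -> F i = Leaf.
Proof.
exists (\max_(j <- finsupp F) j).+1 => i lt; apply/fsfun_dflt/negP => iF.
by have := @leq_bigmax_seq _ _ xpredT id i iF isT; rewrite leqNgt lt.
Qed.

Lemma first_leaf_cherry i j : first_leaf (cherry i) j = (j + (i < j))%N.
Proof.
rewrite /first_leaf.
elim: j => [|j IH]; first by rewrite big_ord0.
rewrite big_ord_recr /= IH /cherry fsfun_withE fsfun0E ltnS addSn -addnS -addnA.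
by congr (_ + _)%N; case: (ltngtP i j).
Qed.

Lemma forest_peel (F : forest) i : F i != Leaf ->
  exists G, forest_mul (cherry i) G = F /\ (forest_size G < forest_size F)%N.
Proof.
case Fi : (F i) => [//|l r] _; have [N hN] := forest_bound F.
have iN : (i < N)%N by rewrite ltnNge; apply/negP => /hN; rewrite Fi.
pose E j := if (j < i)%N then F j else if j == i then l
            else if j == i.+1 then r else F j.-1.
have EN j : (N.+1 <= j)%N -> E j = Leaf.
  move=> Nj; have ij : (i.+1 < j)%N by apply: leq_trans Nj.
  rewrite /E ltnNge (ltnW (ltnW ij)) /= !gtn_eqF //; last exact: ltnW.
  by apply: hN; rewrite -ltnS (ltn_predK ij).
pose G : forest := [fsfun j in [fset j in iota 0 N.+1]%fset => E j].
have GE j : G j = E j.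
  by rewrite /G fsfun_fun in_fset_iota ltnNge; case: leqP => // /EN->.
have Ei : E i = l by rewrite /E ltnn eqxx.
have Ei1 : E i.+1 = r by rewrite /E ltnNge leqnSn /= gtn_eqF // eqxx.
exists G; split.
  apply/fsfunP => j; rewrite forest_mulE first_leaf_cherry /cherry fsfun_withE.
  rewrite fsfun0E; case: (ltngtP i j) => [ij|ji|<-] /=.
  - rewrite addn1 GE /E ltnNge (ltnW (ltnW _)) //= gtn_eqF //; last exact: ltnW.
    by rewrite eqSS gtn_eqF.
  - by rewrite addn0 GE /E ji.
  - by rewrite addn0 addn1 !GE Ei Ei1.
rewrite (forest_sizeEw (N := N.+1)); last by move=> j /EN; rewrite GE.
rewrite (forest_sizeEw hN) (big_cat_nat (n := i)) ?(leqW (ltnW iN)) //=.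
rewrite [X in (_ < X)%N](big_cat_nat (n := i)) ?(ltnW iN) //=.
rewrite [X in (_ + X < _)%N]big_ltn ?(leqW iN) // [X in (_ + (_ + X) < _)%N]big_ltn //.
rewrite [X in (_ < _ + X)%N]big_ltn // Fi big_add1 /=.
have -> : (\sum_(0 <= j < i) nodes (G j) = \sum_(0 <= j < i) nodes (F j))%N.
  by apply: eq_big_nat => j /andP[_ ji]; rewrite GE /E ji.
have -> : (\sum_(i.+1 <= j < N) nodes (G j.+1) = \sum_(i.+1 <= j < N) nodes (F j))%N.
  apply: eq_big_nat => j /andP[ij _]; rewrite GE /E ltnNge (leqW (ltnW ij)) /=.
  by rewrite !gtn_eqF ?ltnS // ltnW.
rewrite !GE Ei Ei1 ltn_add2l addnA /=.
by rewrite addSn.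
Qed.

Lemma forest_word_surj (F : forest) : exists w, forest_word w == F.
Proof.
have [n] := ubnP (forest_size F); elim: n F => // n IH F ltFn.
have [F0|/fset0Pn[i]] := eqVneq (finsupp F) fset0.
  exists [::]; apply/eqP/fsfunP => i.
  by rewrite /= fsfun0E fsfun_dflt // F0.
rewrite mem_finsupp => /forest_peel[G [eG ltG]].
have [w /eqP ew] := IH G (leq_trans ltG ltFn).
by exists (i :: w); rewrite /= ew eG.
Qed.

Definition opT_word (w : seq nat) (f : Pol) : Pol := foldr opT f w.

(* Any factorization of F yields the same operator, since
   opT i \o opT j = opT j \o opT i.+1 for j < i. *)
Definition opT_forest (F : forest) : Pol -> Pol :=
  opT_word (xchoose (forest_word_surj F)).

Definition opRT (k : nat) (H : forest) (f : Pol) : Pol :=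
  iter (k - forest_size H) (opR 0) (opT_forest H f).

(* Main.v *)
Require Import Defs.
From HB Require Import structures.
From mathcomp Require Import all_boot all_order all_algebra finmap.
From mathcomp Require Import zify ring.
From mathcomp.multinomials Require Import monalg.
Import GRing.Theory.
Local Open Scope ring_scope.

Set Implicit Arguments.
Unset Strict Implicit.
Unset Printing Implicit Defensive.

(** Write r = n - k and call y_0, ..., y_(r-1) the variables of the target Pol_r, on which a
    quasisymmetric g acts as multiplication by g(y). The operators R_0, ..., R_(n-1) agree on
    QSym_n, so T_i (g f) = R_0(g) T_i(f) for g in QSym_n and i < n - 1; composing such steps gives
    the first half of the theorem ([opRT_hom]). The second half has two parts.

    Spanning, up to a monomial in the y's. Let Phi be a homomorphism. The monomial quasisymmetric
    polynomial with r parts equal to N acts on Pol_r as (y_0 ... y_(r-1))^N, so this multiple of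
    Phi is the sum, over the r-element sets s of variables, of the maps f |-> Phi (x_s^N f), where
    x_s is the product of the variables in s. When N is large, the variables outside s act
    nilpotently on such a piece ([fat_kill]). Hence a monomial quasisymmetric polynomial with r
    large parts has on it a single surviving term, and comparing a few of them shows that the i-th
    variable of s acts exactly as y_i ([piece_X]), while the quasisymmetric polynomials without
    constant term in the variables of a gap between consecutive elements of s act as zero
    ([piece_gap]). A map which is killed in this way by a block of p consecutive variables is
    determined by its values on the monomials x^u of the block whose exponents satisfy a ballot
    condition ([straightening]); this is the theorem of Aval, Bergeron and Bergeron that these
    monomials span the coinvariants of QSym_p. The products T^u of divided differences are
    unitriangular on these monomials, so the map is a combination of maps Psi_u R^(p-|u|) T^u
    ([gap_decomposition]). Treating the lowest element of s and the gap below it, then going on by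
    induction on r, one finds that a monomial in the y's times Phi is a Pol_r-linear combination
    of words in R_0 and the T_i ([partial_hom_locspan]).

    Integrality and uniqueness. A forest H in For_n is the product of a unique weakly increasing
    word, that is, it is given by an exponent sequence u; the sequences that occur are again the
    ballot ones ([For_word], [valid_word_of]). The relations T_i T_j = T_j T_(i+1), for j < i,
    make T_H the corresponding T^u ([forest_word_op]). Now R_0^(k-|H|) T^u takes the value 1 at
    x^u and 0 at x^v for v below u in the lexicographic order. Evaluating a combination at these
    monomials from the lowest one up therefore yields its coefficients one after the other: they
    are unique, and they are divisible by the monomial above ([triangular_div]).

    Exponent sequences and compositions are listed from the last variable, or the last part, down
    to the first. *)

(** * Polynomial rings with insertion of zeros *)

(** The properties of Z[x_0, x_1, ...] on which the argument rests: variables that are not zero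
    divisors, the maps R_i and T_i, the subrings of polynomials in the first n variables,
    substitutions, and induction on polynomials. Coefficients of monomials only enter to relate
    quasisymmetric polynomials to the maps R_i. *)
Record polySystem := PolySystem {
  psRing : comNzRingType;
  psX : nat -> psRing;
  psR : nat -> {rmorphism psRing -> psRing};
  psT : nat -> {additive psRing -> psRing};
  psIn : nat -> {pred psRing};
  psX_inj : forall i, injective ( *%R (psX i));
  psR_lt : forall i j, (j < i)%N -> psR i (psX j) = psX j;
  psR_eq : forall i, psR i (psX i) = 0;
  psR_ge : forall i j, (i <= j)%N -> psR i (psX j.+1) = psX j;
  psTE : forall i f, psX i * psT i f = psR i.+1 f - psR i f;
  psSubst : forall phi : nat -> psRing,
    {h : {rmorphism psRing -> psRing} | forall i, h (psX i) = phi i};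
  psIn_subring : forall n, subring_closed (psIn n);
  psIn_X : forall n i, (i < n)%N -> psX i \in psIn n;
  psIn_X_div : forall n i f, psX i * f \in psIn n -> f \in psIn n;
  ps_ind : forall P : psRing -> Prop, (forall c : int, P c%:~R) ->
    (forall f g, P f -> P g -> P (f + g)) -> (forall i f, P f -> P (psX i * f)) ->
    forall f, P f;
  ps_indN : forall n (P : psRing -> Prop), (forall c : int, P c%:~R) ->
    (forall f g, P f -> P g -> P (f + g)) ->
    (forall i f, (i < n)%N -> P f -> P (psX i * f)) ->
    forall f, f \in psIn n -> P f
}.

Section Basics.
Variable S : polySystem.
Local Notation A := (@psRing S).
Local Notation x := (@psX S).
Local Notation R := (@psR S).
Local Notation T := (@psT S).
Local Notation PN := (@psIn S).

Lemma In_M n f g : f \in PN n -> g \in PN n -> f * g \in PN n.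
Proof. by case: (@psIn_subring S n) => _ _; apply. Qed.
Lemma In_B n f g : f \in PN n -> g \in PN n -> f - g \in PN n.
Proof. by case: (@psIn_subring S n) => _ + _; apply. Qed.
Lemma In_1 n : 1 \in PN n.
Proof. by case: (@psIn_subring S n). Qed.
Lemma In_0 n : 0 \in PN n.
Proof. by rewrite -(subrr 1); apply: In_B; exact: In_1. Qed.
Lemma In_N n f : f \in PN n -> - f \in PN n.
Proof. by move=> fn; rewrite -sub0r; apply: In_B => //; exact: In_0. Qed.
Lemma In_D n f g : f \in PN n -> g \in PN n -> f + g \in PN n.
Proof. by move=> fn gn; rewrite -[g]opprK; apply: In_B => //; exact: In_N. Qed.
Lemma In_Xn n f k : f \in PN n -> f ^+ k \in PN n.
Proof.
by move=> fn; elim: k => [|k IH]; [exact: In_1 | rewrite exprS; apply: In_M].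
Qed.
Lemma In_sum (I : Type) (r : seq I) (P : pred I) n (F : I -> A) :
  (forall i, P i -> F i \in PN n) -> \sum_(i <- r | P i) F i \in PN n.
Proof. by move=> H; elim/big_ind: _ => //; [exact: In_0 | move=> *; exact: In_D]. Qed.
Lemma In_int n c : c%:~R \in PN n.
Proof.
have Hn m : m%:R \in PN n.
  by elim: m => [|m IH]; [exact: In_0 | rewrite mulrS; apply: In_D => //; exact: In_1].
by case: c => m; [exact: Hn | rewrite NegzE mulrNz; apply: In_N; exact: Hn].
Qed.
Lemma In_le m n f : (m <= n)%N -> f \in PN m -> f \in PN n.
Proof.
move=> le; move: f; apply: ps_indN => [c|f g|i f lt fn]; first exact: In_int.
  exact: In_D.
by apply: In_M => //; apply: psIn_X; exact: leq_trans le.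
Qed.

Lemma mulXn_inj i n : injective ( *%R (x i ^+ n)).
Proof.
by elim: n => [|n IH] f g; rewrite ?expr0 ?mul1r // exprS -!mulrA => /psX_inj/IH.
Qed.

Lemma RR i j f : (i <= j)%N -> R j (R i f) = R i (R j.+1 f).
Proof.
move=> le; move: f; apply: ps_ind => [c|f g e1 e2|l f e].
- by rewrite !rmorph_int.
- by rewrite !raddfD /= e1 e2.
- rewrite !rmorphM /= e; congr (_ * _).
  case: (ltngtP l i) => [li|il|->].
  + by rewrite !psR_lt // ?(leq_trans li) // leqW.
  + case: l il => // l il; rewrite psR_ge //.
    case: (ltngtP l j) => [lj|jl|->].
    * by rewrite (@psR_lt _ j) // (@psR_lt _ j.+1) // psR_ge.
    * by case: l il jl => // l il jl; rewrite !psR_ge // (leq_trans le).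
    * by rewrite !psR_eq rmorph0.
  + by rewrite (@psR_lt _ j.+1) // !psR_eq rmorph0.
Qed.

(** Identities between the T_i are proved by multiplying by the variable and expanding T_i into
    a difference of two R's. *)
Lemma T_unique i f g : x i * g = R i.+1 f - R i f -> T i f = g.
Proof. by rewrite -psTE => /psX_inj. Qed.

Lemma T_eq0 i f : R i.+1 f = R i f -> T i f = 0.
Proof. by move=> e; apply: T_unique; rewrite e subrr mulr0. Qed.

(** The twisted Leibniz rule. *)
Lemma TM i f g : T i (f * g) = R i.+1 f * T i g + T i f * R i g.
Proof.
apply: T_unique; rewrite !rmorphM /=.
transitivity (R i.+1 f * (x i * T i g) + (x i * T i f) * R i g); first by ring.
by rewrite !psTE; ring.
Qed.

(** The source of all the linearity statements below: a factor on which R_i and R_(i+1) agree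
    comes out of T_i. *)
Lemma TMl i f g : R i.+1 f = R i f -> T i (f * g) = R i f * T i g.
Proof. by move=> e; rewrite TM (T_eq0 e) mul0r addr0 e. Qed.

(** For j = 0 this makes R_0 one more divided difference, below T_0: it has the commutation rule
    that [TT] would give to the index -1. *)
Lemma R_T i j f : (j <= i)%N -> R j (T i.+1 f) = T i (R j f).
Proof.
move=> le; apply/esym/T_unique.
by rewrite (RR f (leqW le)) (RR f le) -raddfB /= -psTE rmorphM /= psR_ge.
Qed.

(** The relations of the monoid of forests. *)
Lemma TT i j f : (j < i)%N -> T i (T j f) = T j (T i.+1 f).
Proof.
move=> lt; apply/esym/T_unique.
rewrite (R_T _ lt) (R_T _ (ltnW lt)) -raddfB /= -psTE TMl ?psR_lt //; exact: leqW.
Qed.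

Lemma R_in n i f : (i <= n)%N -> f \in PN n.+1 -> R i f \in PN n.
Proof.
move=> le; move: f; apply: ps_indN => [c|f g|j f jn]; rewrite ?rmorph_int ?In_int //.
- by rewrite raddfD; exact: In_D.
- rewrite rmorphM; apply: In_M => //=.
  case: (ltngtP j i) => [ji|ij|->]; last by rewrite psR_eq In_0.
    by rewrite psR_lt // psIn_X // (leq_trans ji).
  by case: j ij jn => // j ij jn; rewrite psR_ge // psIn_X.
Qed.

Lemma R_id n i f : (n <= i)%N -> f \in PN n -> R i f = f.
Proof.
move=> le; move: f; apply: ps_indN => [c|f g e1 e2|j f jn e]; rewrite ?rmorph_int //.
- by rewrite raddfD /= e1 e2.
- by rewrite rmorphM /= e psR_lt // (leq_trans jn).
Qed.

Lemma T_in n i f : (i < n)%N -> f \in PN n.+1 -> T i f \in PN n.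
Proof.
move=> lt fn; apply: (@psIn_X_div _ _ i); rewrite psTE.
by apply: In_B; apply: R_in => //; exact: ltnW.
Qed.

(** All insertions are combinations of R_0 and the T_i, by telescoping. *)
Lemma R_T_sum l f : R l f = R 0 f + \sum_(i < l) x i * T i f.
Proof.
elim: l => [|l IH]; first by rewrite big_ord0 addr0.
by rewrite big_ord_recr /= psTE addrA -IH addrC subrK.
Qed.
End Basics.

Section Qsym.
Variable S : polySystem.
Local Notation A := (@psRing S).
Local Notation x := (@psX S).
Local Notation R := (@psR S).
Local Notation T := (@psT S).
Local Notation PN := (@psIn S).

(** * Monomial and fundamental quasisymmetric polynomials *)

(** The monomial quasisymmetric polynomial of a composition in the variables
    x_l, ..., x_(l+m-1); the recursion separates the terms that involve the last variable. *)
Fixpoint qsymM (l : nat) (b : seq nat) (m : nat) {struct m} : A :=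
  if b is c :: b' then
    if m is m'.+1 then qsymM l b m' + x (l + m') ^+ c * qsymM l b' m' else 0
  else 1.

Lemma qsymM_nil l m : qsymM l [::] m = 1.
Proof. by case: m. Qed.

Lemma qsymM_0 l c b : qsymM l (c :: b) 0 = 0.
Proof. by []. Qed.

Lemma qsymM_S l c b m : qsymM l (c :: b) m.+1 = qsymM l (c :: b) m + x (l + m) ^+ c * qsymM l b m.
Proof. by []. Qed.
Arguments qsymM : simpl never.

Lemma qsymM_in l b m : qsymM l b m \in PN (l + m).
Proof.
elim: m b => [|m IH] [|c b]; rewrite ?qsymM_nil ?qsymM_0 ?In_1 ?In_0 // qsymM_S addnS; apply: In_D.
  by apply: In_le (IH _).
by apply: In_M; [apply/In_Xn/psIn_X | apply: In_le (IH _)].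
Qed.

(** Quasisymmetry: inserting a zero at any place just removes a variable. *)
Lemma qsymM_R l b q i : all (leq 1) b -> (i <= q)%N -> R (l + i) (qsymM l b q.+1) = qsymM l b q.
Proof.
elim: q i b => [|q IH] i [|c b] // posb le; try by rewrite !qsymM_nil rmorph1.
- case/andP: posb => c0 _; move: le; rewrite leqn0 => /eqP->.
  by rewrite qsymM_S !qsymM_0 add0r rmorphM rmorphXn /= psR_eq expr0n gtn_eqF // mul0r.
- case/andP: (posb) => c0 pb; rewrite qsymM_S rmorphD rmorphM rmorphXn /=.
  case: (ltngtP i q.+1) le => // [iq|->] _.
    by rewrite !IH // addnS psR_ge // leq_add2l.
  rewrite psR_eq expr0n gtn_eqF // mul0r addr0.
  by rewrite (R_id (leqnn _)) //; exact: qsymM_in.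
Qed.

Lemma qsymM_gt l b m : (m < size b)%N -> qsymM l b m = 0.
Proof.
elim: m b => [|m IH] [|c b] //= lt; rewrite ?qsymM_0 // qsymM_S IH ?IH ?mulr0 ?addr0 //.
exact: leqW.
Qed.

Lemma qsymM_size l c b : qsymM l (c :: b) (size b).+1 = x (l + size b) ^+ c * qsymM l b (size b).
Proof. by rewrite qsymM_S qsymM_gt ?add0r /=. Qed.

(** With as many variables as parts there is a single term, which is not a zero divisor. *)
Lemma qsymM_size_inj l b : injective ( *%R (qsymM l b (size b))).
Proof.
elim: b => [|c b IH] f g; first by rewrite qsymM_nil !mul1r.
by rewrite [size _]/= qsymM_size -!mulrA => /mulXn_inj/IH.
Qed.

(** The coproduct: each part is carried either by the first p variables or by the others. *)
Lemma qsymM_cat l b p m : qsymM l b (p + m) =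
  \sum_(i < (size b).+1) qsymM (l + p) (take i b) m * qsymM l (drop i b) p.
Proof.
elim: m b => [|m IH] b.
  rewrite addn0 big_ord_recl take0 drop0 qsymM_nil mul1r big1 ?addr0 // => i _ /=.
  by case: b i => [[]//|c b] i; rewrite /= qsymM_0 mul0r.
case: b => [|c b]; first by rewrite big_ord1 /= !qsymM_nil mulr1.
rewrite addnS qsymM_S !IH big_ord_recl [RHS]big_ord_recl !take0 !drop0 !qsymM_nil -addrA.
congr (_ + _); rewrite big_distrr -big_split /=; apply: eq_bigr => i _.
by rewrite !add0n qsymM_S addnA; ring.
Qed.

(** The fundamental quasisymmetric polynomial of a composition is the sum of the monomial ones
    over its refinements. When the last part grows by one, the last part of a refinement either
    grows as well or is followed by a new part 1. *)
Definition grow_last (L : seq (seq nat)) : seq (seq nat) :=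
  flatten [seq [:: (head 0%N g).+1 :: behead g; 1%N :: g] | g <- L].

Fixpoint refinements (b : seq nat) : seq (seq nat) :=
  if b is c :: b' then iter c.-1 grow_last [seq 1%N :: g | g <- refinements b'] else [:: [::]].

Definition qsymF l b m : A := \sum_(g <- refinements b) qsymM l g m.

Lemma refinements_pos b : all (all (leq 1)) (refinements b).
Proof.
elim: b => [|c b IH] //=; elim: c.-1 => [|n IHn] /=; first by rewrite all_map.
apply/allP => h /flatten_mapP[g /(allP IHn) pg]; rewrite !inE => /orP[]/eqP-> //.
by case: g pg => //= d g /andP[].
Qed.

Lemma refinements_neq0 c b : all (fun g => g != [::]) (refinements (c :: b)).
Proof.
rewrite /=; elim: c.-1 => [|n IHn] /=; first by rewrite all_map; apply/allP.
by apply/allP => h /flatten_mapP[g _]; rewrite !inE => /orP[]/eqP->.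
Qed.

Lemma qsymF_nil l m : qsymF l [::] m = 1.
Proof. by rewrite /qsymF big_seq1 qsymM_nil. Qed.

(** The next two recursions are the reason for using the fundamental basis: multiplication by
    the last variable removes a single unit from the last part, whereas in the monomial basis it
    takes a power of the variable to remove the whole part. *)
Lemma qsymF_1 l b m : qsymF l (1%N :: b) m.+1 = qsymF l (1%N :: b) m + x (l + m) * qsymF l b m.
Proof.
rewrite /qsymF /= !big_map big_distrr -big_split /=; apply: eq_bigr => g _.
by [].
Qed.

Lemma qsymF_SS l c b m :
  qsymF l (c.+2 :: b) m.+1 = qsymF l (c.+2 :: b) m + x (l + m) * qsymF l (c.+1 :: b) m.+1.
Proof.
rewrite /qsymF [refinements (c.+2 :: b)]/= -[iter c _ _]/(refinements (c.+1 :: b)).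
rewrite /grow_last !big_flatten !big_map big_distrr -big_split /=.
apply: eq_big_seq => g /(allP (refinements_neq0 c.+1 b)).
case: g => // d g _; rewrite !big_cons !big_nil !addr0 !qsymM_S /= exprS expr1; ring.
Qed.

(** * Exponent sequences and the variables of a gap *)

(** The monomial in x_l, x_(l+1), ... whose exponents are listed from the highest variable down;
    the length of the sequence is the number of variables. *)
Fixpoint xmon (l : nat) (u : seq nat) : A :=
  if u is a :: u' then x (l + size u') ^+ a * xmon l u' else 1.

Lemma xmon_in l u : xmon l u \in PN (l + size u).
Proof.
elim: u => [|a u IH] /=; rewrite ?In_1 // addnS.
by apply: In_M; [apply/In_Xn/psIn_X | apply: In_le IH].
Qed.

Lemma xmon0 l p : xmon l (nseq p 0%N) = 1.
Proof. by elim: p => //= p ->; rewrite expr0 mulr1. Qed.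

(** The lexicographic order in which the highest variable counts most. *)
Fixpoint lexlt (u v : seq nat) : bool :=
  match u, v with
  | a :: u', b :: v' => (a < b)%N || ((a == b) && lexlt u' v')
  | _, _ => false
  end.

Lemma lexlt_irr u : lexlt u u = false.
Proof. by elim: u => //= a u ->; rewrite ltnn eqxx. Qed.

Lemma lexlt_trans : transitive lexlt.
Proof.
elim=> [|b v IH] [|a u] [|c w] //=.
case/orP=> [ab|/andP[/eqP-> uv]] /orP[bc|/andP[/eqP<- vw]]; rewrite ?ab ?bc //.
- by rewrite (ltn_trans ab bc).
- by rewrite (IH _ _ uv vw) eqxx orbT.
Qed.

Lemma lexlt_total u v : size u = size v -> [|| lexlt u v, u == v | lexlt v u].
Proof.
elim: u v => [|a u IH] [|b v] //= [/IH H].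
by rewrite eqseq_cons; case: (ltngtP a b) => //= ->.
Qed.

(** The order is well founded on the sequences of a given length. *)
Lemma lexlt_ind p (P : seq nat -> Prop) :
  (forall u, size u = p -> (forall v, size v = p -> lexlt v u -> P v) -> P u) ->
  forall u, size u = p -> P u.
Proof.
elim: p P => [|p IH] P H u; first by case: u => // _; apply: H => // -[].
case: u => // a u [].
have [N] := ubnP a; elim: N a u => // N IHa a u ltN.
move: u; apply: IH => u su IHu; apply: H; first by rewrite /= su.
case=> // b v [sv] /= /orP[ba|/andP[/eqP-> vu]]; last exact: IHu.
by apply: IHa => //; apply: leq_trans ba _; rewrite -ltnS.
Qed.

(** Makes room for a gap of q variables at place l. Its values are the polynomials which do not
    involve the gap, and R_l^q undoes it. *)
Definition insert_gap l q : {rmorphism A -> A} :=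
  sval (psSubst (fun i => if (i < l)%N then x i else x (i + q))).

Lemma insert_X l q i : insert_gap l q (x i) = if (i < l)%N then x i else x (i + q).
Proof. by rewrite /insert_gap; case: psSubst. Qed.

Lemma rmorph_ext (h k : {rmorphism A -> A}) : (forall i, h (x i) = k (x i)) -> h =1 k.
Proof.
move=> e; apply: ps_ind => [c|f g e1 e2|i f e1]; first by rewrite !rmorph_int.
  by rewrite !rmorphD /= e1 e2.
by rewrite !rmorphM /= e e1.
Qed.

Lemma insert_R l q i c : (i <= q)%N -> R (l + i) (insert_gap l q.+1 c) = insert_gap l q c.
Proof.
move=> le; move: c; apply: (@rmorph_ext (R (l + i) \o insert_gap l q.+1)) => j /=.
rewrite !insert_X; case: ltnP => jl; first by rewrite psR_lt // ltn_addr.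
by rewrite addnS psR_ge // leq_add.
Qed.

Lemma insert_0 l c : insert_gap l 0 c = c.
Proof.
move: c; apply: (@rmorph_ext (insert_gap l 0) idfun) => j /=.
by rewrite insert_X addn0 if_same.
Qed.

Lemma insert_qsymM l q l' b m : (l <= l')%N -> insert_gap l q (qsymM l' b m) = qsymM (l' + q) b m.
Proof.
move=> le; elim: m b => [|m IH] [|c b]; rewrite ?qsymM_nil ?qsymM_0 ?rmorph0 ?rmorph1 // !qsymM_S.
rewrite rmorphD rmorphM rmorphXn /= !IH insert_X ltnNge (leq_trans le) ?leq_addr //=.
by rewrite addnAC.
Qed.
End Qsym.
Arguments qsymM : simpl never.

Section Straighten.
Variable S : polySystem.
Local Notation A := (@psRing S).
Local Notation x := (@psX S).
Local Notation R := (@psR S).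
Local Notation T := (@psT S).
Local Notation PN := (@psIn S).
Local Notation qsymM := (@qsymM S).
Local Notation qsymF := (@qsymF S).
Local Notation xmon := (@xmon S).
Local Notation insert_gap := (@insert_gap S).

Lemma xmon_cat l v u : xmon l (v ++ u) = xmon (l + size u) v * xmon l u.
Proof.
elim: v => [|a v IH] /=; first by rewrite mul1r.
by rewrite IH mulrA size_cat addnA addnAC.
Qed.

Definition add_exponents (u w : seq nat) := [seq (a.1 + a.2)%N | a <- zip u w].

Lemma xmon_mul l u w : size u = size w -> xmon l u * xmon l w = xmon l (add_exponents u w).
Proof.
elim: u w => [|a u IH] [|b w] //=; first by rewrite mulr1.
case=> e; rewrite -IH // size_map size_zip e minnn exprD; ring.
Qed.

(** * Straightening modulo the quasisymmetric polynomials of a gap *)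

(** The additive group generated by the monomials x^u with u in P. *)
Inductive zspan l (P : pred (seq nat)) : A -> Prop :=
| zspan0 : zspan l P 0
| zspanD f u : P u -> zspan l P f -> zspan l P (f + xmon l u)
| zspanB f u : P u -> zspan l P f -> zspan l P (f - xmon l u).

Lemma zspan_xmon l (P : pred (seq nat)) u : P u -> zspan l P (xmon l u).
Proof. by move=> Pu; rewrite -[xmon l u]add0r; apply: zspanD => //; exact: zspan0. Qed.

Lemma zspan_add l P f g : zspan l P f -> zspan l P g -> zspan l P (f + g).
Proof.
move=> fP; elim=> [|h u Pu _ IH|h u Pu _ IH]; rewrite ?addr0 // addrA.
  exact: zspanD.
exact: zspanB.
Qed.

Lemma zspan_opp l P f : zspan l P f -> zspan l P (- f).
Proof.
elim=> [|h u Pu _ IH|h u Pu _ IH]; rewrite ?oppr0 ?opprD ?opprK; first exact: zspan0.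
  exact: zspanB.
exact: zspanD.
Qed.

Lemma zspan_bind l l' (P Q : pred (seq nat)) g f :
  (forall u, P u -> zspan l' Q (g * xmon l u)) -> zspan l P f -> zspan l' Q (g * f).
Proof.
move=> H; elim=> [|h u Pu _ IH|h u Pu _ IH]; first by rewrite mulr0; exact: zspan0.
  by rewrite mulrDr; apply: zspan_add => //; exact: H.
by rewrite mulrBr; apply: zspan_add => //; apply: zspan_opp; exact: H.
Qed.

Lemma zspan_sub l (P Q : pred (seq nat)) f : (forall u, P u -> Q u) -> zspan l P f -> zspan l Q f.
Proof.
move=> H fP; rewrite -[f]mul1r; apply: zspan_bind fP => u /H Qu.
by rewrite mul1r; exact: zspan_xmon.
Qed.

Lemma zspan_sum l P (I : Type) (r : seq I) (F : I -> A) :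
  (forall i, zspan l P (F i)) -> zspan l P (\sum_(i <- r) F i).
Proof. by move=> H; elim/big_ind: _ => //; [exact: zspan0 | move=> *; exact: zspan_add]. Qed.

Definition of_size m : pred (seq nat) := fun u => size u == m.

Lemma zspan_qsymM l b m : zspan l (of_size m) (qsymM l b m).
Proof.
elim: m b => [|m IH] [|c b].
- by rewrite qsymM_nil; apply: (@zspan_xmon l (of_size 0) [::]).
- by rewrite qsymM_0; exact: zspan0.
- by rewrite qsymM_nil -(xmon0 S l m.+1); apply: zspan_xmon; rewrite /of_size size_nseq.
- rewrite qsymM_S; apply: zspan_add; last first.
    apply: zspan_bind (IH b) => u /eqP su.
    by rewrite -su -[_ * _]/(xmon l (c :: u)); apply: zspan_xmon; rewrite /of_size /= su.
  rewrite -[qsymM _ _ _]mul1r; apply: zspan_bind (IH _) => u /eqP su.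
  have -> : 1 * xmon l u = xmon l (0%N :: u) by rewrite /= expr0.
  by apply: zspan_xmon; rewrite /of_size /= su.
Qed.

Lemma zspan_qsymF l b m : zspan l (of_size m) (qsymF l b m).
Proof. by apply: zspan_sum => g; exact: zspan_qsymM. Qed.

(** The leading part of a fundamental polynomial with respect to the last variable. *)
Lemma qsymF_lead l c b m :
  zspan l (fun u => (size u == m.+1) && (head 0%N u < c.+1)%N)
    (qsymF l (c.+1 :: b) m.+1 - x (l + m) ^+ c.+1 * qsymF l b m).
Proof.
have low d n f : (d < n)%N -> zspan l (of_size m) f ->
    zspan l (fun u => (size u == m.+1) && (head 0%N u < n)%N) (x (l + m) ^+ d * f).
  move=> dn; apply: zspan_bind => u /eqP su.
  rewrite -su -[_ * _]/(xmon l (d :: u)); apply: zspan_xmon.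
  by rewrite /= dn eqxx.
elim: c => [|c IH].
  rewrite qsymF_1 expr1 addrK -[qsymF _ _ _]mul1r -(expr0 (x (l + m))).
  by apply: low => //; exact: zspan_qsymF.
rewrite qsymF_SS exprS -mulrA -addrA -mulrBr; apply: zspan_add.
  by rewrite -[qsymF _ _ _]mul1r -(expr0 (x (l + m))); apply: low => //; exact: zspan_qsymF.
apply: zspan_bind IH => -[//|d u] /andP[/= /eqP[su] dc].
rewrite mulrA su -exprS -su -[_ * _]/(xmon l (d.+1 :: u)); apply: zspan_xmon.
by rewrite /= eqxx.
Qed.

Lemma lexlt_catl v u w : lexlt (v ++ u) (v ++ w) = lexlt u w.
Proof. by elim: v => //= a v ->; rewrite ltnn eqxx. Qed.

Lemma lexlt_catr u1 u2 w1 w2 : lexlt u1 u2 -> lexlt (u1 ++ w1) (u2 ++ w2).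
Proof.
elim: u1 u2 => [|a u1 IH] [|b u2] //= /orP[->//|/andP[/eqP-> /IH->]].
by rewrite eqxx orbT.
Qed.

(** The exponents which are already lower than those of v in the topmost variables, whatever
    they are in the other ones. *)
Definition lower p (v : seq nat) : pred (seq nat) :=
  fun u => (size u == p) && lexlt (take (size v) u) v.

Lemma lexlt_rcons0 u a v : size u = size v -> lexlt (rcons u a) (rcons v 0%N) = lexlt u v.
Proof.
elim: u v => [|b u IH] [|c v] //=; first by rewrite andbF.
by case=> e; rewrite IH.
Qed.

Lemma lower_rcons p v c u : (size v < p)%N -> lower p v u -> lower p (rcons v c) u.
Proof.
move=> vp /andP[/eqP su lt]; rewrite /lower su eqxx /= size_rcons.
by rewrite (take_nth 0%N) ?su // -!cats1; exact: lexlt_catr.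
Qed.

(** Nothing is lower than an exponent 0, so a final 0 in v can be dropped. *)
Lemma lower_rcons0 p v u : (size v < p)%N -> lower p (rcons v 0%N) u -> lower p v u.
Proof.
move=> vp /andP[/eqP su]; rewrite /lower su eqxx /= size_rcons.
by rewrite (take_nth 0%N) ?su // lexlt_rcons0 // size_take su vp.
Qed.

(** Multiplication by a variable below those of v does not change the comparison with v. *)
Lemma zspan_lowerX l p v m f : (size v + m).+1 = p -> zspan l (lower p v) f ->
  zspan l (lower p v) (x (l + m) * f).
Proof.
move=> ep; apply: zspan_bind => u /andP[/eqP su lt].
rewrite -(cat_take_drop (size v) u); set t := take _ u in lt *.
have st : size t = size v by rewrite size_take su -ep; case: ltnP => //; lia.
have sd : size (drop (size v) u) = m.+1 by rewrite size_drop su -ep; lia.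
case: (drop _ _) sd => // a w [sw].
rewrite xmon_cat mulrCA (_ : x (l + m) * xmon l (a :: w) = xmon l (a.+1 :: w)); last first.
  by rewrite /= sw exprS mulrA.
have -> : size (a :: w) = size (a.+1 :: w) by [].
rewrite -xmon_cat; apply: zspan_xmon; rewrite /lower size_cat st /= sw -ep addnS eqxx /=.
by rewrite -st take_size_cat.
Qed.

Variables (l p : nat) (Phi : A -> A).
Hypothesis PhiD : {morph Phi : f g / f + g}.
Hypothesis PhiM : forall g f, all (leq 1) g -> g != [::] -> Phi (qsymM l g p * f) = 0.

Let Phi0 : Phi 0 = 0.
Proof. by apply: (@addrI _ (Phi 0)); rewrite -PhiD !addr0. Qed.
Let PhiN f : Phi (- f) = - Phi f.
Proof. by apply: (@addrI _ (Phi f)); rewrite -PhiD !subrr Phi0. Qed.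

Let kills G := forall f, Phi (G * f) = 0.

Let kills_qF b : b != [::] -> kills (qsymF l b p).
Proof.
case: b => // c b _ f; rewrite /qsymF.
have : all (fun g => all (leq 1) g && (g != [::])) (refinements (c :: b)).
  by apply/allP => g gb; rewrite (allP (refinements_pos _) _ gb) (allP (refinements_neq0 _ _) _ gb).
elim: (refinements _) => [|g s IH]; first by rewrite big_nil mul0r.
by move=> /= /andP[/andP[pg ng] /IH]; rewrite big_cons mulrDl PhiD PhiM // add0r.
Qed.

(** Elements of the ideal with a prescribed leading part: x^v times a fundamental polynomial in
    the remaining variables. With [b] empty, every monomial x^v in the topmost variables with |v|
    at least their number is a leading monomial of the ideal. The numerical condition keeps the
    composition nonempty when the induction reaches v = [::]. The last entry c of v is treated as
    follows. If c > 0, then it joins the composition. If c = 0, then the recursion for the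
    fundamental polynomials expresses the one without the variable x_(l+m) through two with one
    unit of length less. *)
Lemma leading_term v b : all (leq 1) b -> (size v + size b <= p)%N ->
  (0 < size v + size b <= sumn v + sumn b)%N ->
  exists G, kills G /\
    zspan l (lower p v) (G - xmon (l + (p - size v)) v * qsymF l b (p - size v)).
Proof.
have [N] := ubnP (size v + size b); elim: N v b => // N IHN v.
elim/last_ind: v => [|v c IHv] b ltN posb lep /andP[gt0 lesum].
  exists (qsymF l b p); split; last by rewrite subn0 /= mul1r subrr; exact: zspan0.
  by apply: kills_qF; case: b {ltN posb lep lesum} gt0.
move: ltN lep gt0 lesum; rewrite !size_rcons -cats1 sumn_cat /= addn0 => ltN lep gt0 lesum.
set m := (p - (size v).+1)%N.
have pm : (p - size v)%N = m.+1 by rewrite /m; lia.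
have vm : (size v + m).+1 = p by rewrite /m; lia.
have vp : (size v < p)%N by lia.
have Ec d : xmon (l + m) (v ++ [:: d]) = xmon (l + m.+1) v * x (l + m) ^+ d.
  by rewrite xmon_cat /= addn0 mulr1 -addnA addn1.
have toL f : zspan l (lower p v) f -> zspan l (lower p (v ++ [:: c])) f.
  by rewrite cats1; apply: zspan_sub => u; exact: lower_rcons.
case: c IHv lesum toL => [|c] IHv lesum toL; last first.
  (* the same element works: x_(l+m)^(c+1) F_b is the leading part of F_(b, c+1) *)
  case: (IHv (c.+1 :: b)) => //=; try lia. move=> G [GK GL]; exists G; split => //.
  rewrite pm in GL; rewrite Ec.
  have -> : G - xmon (l + m.+1) v * x (l + m) ^+ c.+1 * qsymF l b m =
     (G - xmon (l + m.+1) v * qsymF l (c.+1 :: b) m.+1) +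
     xmon (l + m.+1) v * (qsymF l (c.+1 :: b) m.+1 - x (l + m) ^+ c.+1 * qsymF l b m) by ring.
  apply: zspan_add; first exact: toL.
  apply: zspan_bind (qsymF_lead _ _ _ _) => -[//|d u] /andP[/= /eqP[su] dc].
  have -> : xmon (l + m.+1) v * (x (l + size u) ^+ d * xmon l u) = xmon l (v ++ d :: u).
    by rewrite xmon_cat /= su.
  apply: zspan_xmon; rewrite /lower !size_cat /= su addnS vm eqxx /=.
  have -> : take (size v + 1) (v ++ d :: u) = v ++ [:: d].
    by rewrite -cat_rcons take_size_cat ?size_rcons ?addn1 // cats1.
  by rewrite lexlt_catl /= dc.
rewrite Ec expr0 mulr1.
case: b posb ltN lep gt0 lesum => [|[|[|a]] b] //= posb ltN lep gt0 lesum.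
- (* the fundamental polynomial of the empty composition is 1 *)
  have v0 : (0 < size v)%N by rewrite lt0n; apply: contraTneq lesum => /size0nil->.
  case: (IHN v [::]) => //=; try lia. move=> G [GK GL]; exists G; split => //.
  by apply: toL; rewrite pm in GL; rewrite !qsymF_nil in GL *.
- (* F_(b, 1)(m) = F_(b, 1)(m + 1) - x_(l+m) F_b(m); the second one has the exponent 0 at x_(l+m) *)
  case: (IHN v (1%N :: b)) => //=; try lia. move=> G1 [G1K G1L].
  case: (IHN (rcons v 0%N) b); rewrite ?size_rcons ?sumn_rcons //; try lia.
  move=> G2 [G2K G2L]; rewrite pm in G1L; rewrite -/m -cats1 Ec expr0 mulr1 in G2L.
  exists (G1 - x (l + m) * G2); split.
    move=> f; rewrite (_ : _ * f = G1 * f - G2 * (x (l + m) * f)); last by ring.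
    by rewrite PhiD PhiN G1K G2K subr0.
  have -> : G1 - x (l + m) * G2 - xmon (l + m.+1) v * qsymF l (1%N :: b) m =
    (G1 - xmon (l + m.+1) v * qsymF l (1%N :: b) m.+1) -
    x (l + m) * (G2 - xmon (l + m.+1) v * qsymF l b m) by rewrite qsymF_1; ring.
  apply: toL; apply: zspan_add => //; apply: zspan_opp; apply: zspan_lowerX => //.
  by apply: zspan_sub G2L => u; rewrite cats1; exact: lower_rcons0.
- (* F_(b, a+2)(m) = F_(b, a+2)(m + 1) - x_(l+m) F_(b, a+1)(m + 1) *)
  case: (IHN v (a.+2 :: b)) => //=; try lia. move=> G1 [G1K G1L].
  case: (IHN v (a.+1 :: b)) => //=; try lia. move=> G2 [G2K G2L].
  rewrite pm in G1L G2L.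
  exists (G1 - x (l + m) * G2); split.
    move=> f; rewrite (_ : _ * f = G1 * f - G2 * (x (l + m) * f)); last by ring.
    by rewrite PhiD PhiN G1K G2K subr0.
  have -> : G1 - x (l + m) * G2 - xmon (l + m.+1) v * qsymF l (a.+2 :: b) m =
    (G1 - xmon (l + m.+1) v * qsymF l (a.+2 :: b) m.+1) -
    x (l + m) * (G2 - xmon (l + m.+1) v * qsymF l (a.+1 :: b) m.+1) by rewrite qsymF_SS; ring.
  by apply: toL; apply: zspan_add => //; apply: zspan_opp; apply: zspan_lowerX.
Qed.

(** The ballot condition, as it appears when T^u is applied to a gap of q variables from the
    highest variable down: a positive exponent a at the place i above [size u'] others is allowed
    if T_i can be applied a times, each application needing two variables x_i, x_(i+1) in the gap
    and shortening the gap by one. *)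
Fixpoint ballot q (u : seq nat) : bool :=
  if u is a :: u' then ((a == 0%N) || (size u' + a < q)%N) && ballot (q - a)%N u' else true.

(** Where the condition first fails, the exponents read so far are too large; they are the
    leading exponents of an element of the ideal by [leading_term]. *)
Lemma not_ballot q u : ~~ ballot q u ->
  exists v w, [/\ u = v ++ w, (0 < size v)%N & (q <= sumn v + size w)%N].
Proof.
elim: u q => //= a u IH q; rewrite negb_and negb_or -leqNgt.
case/orP=> [/andP[a0 le]|/IH [v [w [-> v0 le]]]].
  by exists [:: a], u; split => //=; lia.
by exists (a :: v), w; split => //=; lia.
Qed.

Hypothesis PhiB : forall u h, size u = p -> ballot p u -> Phi (xmon l u * insert_gap l p h) = 0.

(** A monomial which violates the ballot condition is congruent to lower monomials; conclude by
    well-founded induction. *)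
Lemma straighten_xmon u h : size u = p -> Phi (xmon l u * insert_gap l p h) = 0.
Proof.
move: u; apply: lexlt_ind => u su IH.
case: (boolP (ballot p u)) => [/PhiB->//|/not_ballot [v [w [eu v0 le]]]].
have sp : p = (size v + size w)%N by rewrite -su eu size_cat.
case: (@leading_term v [::]) => //=; try lia. move=> G [GK].
rewrite qsymF_nil mulr1 (_ : p - size v = size w)%N; last lia.
move=> GL; rewrite eu xmon_cat.
have : Phi ((G - xmon (l + size w) v) * (xmon l w * insert_gap l p h)) = 0; last first.
  by rewrite mulrBl PhiD GK add0r PhiN mulrA => /eqP; rewrite oppr_eq0 => /eqP.
have K u' : lower p v u' -> Phi (xmon l u' * (xmon l w * insert_gap l p h)) = 0.
  case/andP=> /eqP su' lt; rewrite mulrA.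
  have st : size (take (size v) u') = size v by rewrite size_take su'; case: ltnP; lia.
  have sd : size (drop (size v) u') = size w by rewrite size_drop su'; lia.
  rewrite -(cat_take_drop (size v) u') xmon_cat sd -(mulrA (xmon _ _)) xmon_mul //.
  have sa : size (add_exponents (drop (size v) u') w) = size w.
    by rewrite size_map size_zip sd minnn.
  rewrite (_ : xmon (l + size w) (take (size v) u') =
    xmon (l + size (add_exponents (drop (size v) u') w)) (take (size v) u')); last by rewrite sa.
  rewrite -xmon_cat; apply: IH; first by rewrite size_cat st sa -sp.
  by rewrite eu; exact: lexlt_catr.
elim: GL => [|f u' Pu' _ IHf|f u' Pu' _ IHf]; rewrite ?mul0r //.
  by rewrite mulrDl PhiD IHf K // add0r.
by rewrite mulrBl PhiD PhiN IHf K // subrr.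
Qed.

(** Every polynomial is a sum of monomials in the gap times polynomials outside of it. *)
Inductive gap_span : A -> Prop :=
| gspan0 : gap_span 0
| gspanD f u h : size u = p -> gap_span f -> gap_span (f + xmon l u * insert_gap l p h).

Lemma gap_span_all f : gap_span f.
Proof.
move: f; apply: ps_ind => [c|f g fs gs|i f].
- rewrite (_ : c%:~R = 0 + xmon l (nseq p 0%N) * insert_gap l p c%:~R); last first.
    by rewrite xmon0 rmorph_int mul1r add0r.
  by apply: gspanD; [rewrite size_nseq | exact: gspan0].
- elim: gs => [|g' u h su _ IH]; first by rewrite addr0.
  by rewrite addrA; exact: gspanD.
elim=> [|g u h su _ IH]; first by rewrite mulr0; exact: gspan0.
rewrite mulrDr.
case: (ltnP i l) => [il|li].
  rewrite mulrCA (_ : x i * insert_gap l p h = insert_gap l p (x i * h)); first exact: gspanD.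
  by rewrite rmorphM /= insert_X il.
case: (leqP (l + p) i) => [pi|ip].
  rewrite mulrCA (_ : x i * insert_gap l p h = insert_gap l p (x (i - p) * h)); first exact: gspanD.
  rewrite rmorphM /= insert_X ifN ?subnK //; lia.
pose v := take (p - (i - l)).-1 u; pose w := drop (p - (i - l)).-1 u.
have eu : u = v ++ w by rewrite cat_take_drop.
have sw : size w = (i - l).+1 by rewrite size_drop su; lia.
case: w sw eu => // a w [sw] eu.
rewrite mulrA (_ : x i * xmon l u = xmon l (v ++ a.+1 :: w)).
  by apply: gspanD => //; rewrite -su eu !size_cat.
rewrite eu !xmon_cat /= mulrCA exprS mulrA.
by rewrite (_ : l + size w = i)%N ?mulrA // sw subnKC.
Qed.

(** The theorem of Aval, Bergeron and Bergeron in dual form: a map that vanishes on the ideal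
    generated by the quasisymmetric polynomials of the gap without constant term, and on the
    ballot monomials, is zero. *)
Lemma straightening f : Phi f = 0.
Proof.
elim: (gap_span_all f) => // g u h su _ IH.
by rewrite PhiD IH straighten_xmon // addr0.
Qed.
End Straighten.

Section Gap.
Variable S : polySystem.
Local Notation A := (@psRing S).
Local Notation x := (@psX S).
Local Notation R := (@psR S).
Local Notation T := (@psT S).
Local Notation PN := (@psIn S).
Local Notation qsymM := (@qsymM S).
Local Notation xmon := (@xmon S).
Local Notation insert_gap := (@insert_gap S).

(** * Divided differences on a gap *)

(** The product T^u of divided differences, the highest index being applied first. *)
Fixpoint powT l (u : seq nat) (f : A) : A :=
  if u is a :: u' then powT l u' (iter a (T (l + size u')) f) else f.

(** T^u followed by as many R_l as are needed to remove the whole gap. *)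
Definition gapT l p u f := iter (p - sumn u) (R l) (powT l u f).

(** A family c_q of elements, one for each length q of the gap, from which inserting a zero in
    the gap produces the next shorter one. Such factors come out of T^u ([powT_cM]). Instances
    are the polynomials that do not involve the gap and the quasisymmetric polynomials in its
    variables. *)
Definition zero_stable l Q (c : nat -> A) :=
  forall q i, (q < Q)%N -> (i <= q)%N -> R (l + i) (c q.+1) = c q.

Lemma ballot_sumn q u : ballot q u -> (sumn u <= q)%N.
Proof.
elim: u q => //= a u IH q /andP[h /IH le].
by case/orP: h => [/eqP a0|lt]; lia.
Qed.

Lemma powT_cM l Q q u c f : zero_stable l Q c -> (q <= Q)%N -> ballot q u ->
  powT l u (c q * f) = c (q - sumn u)%N * powT l u f.
Proof.
move=> st; elim: u q f => [|a u IH] q f qQ /=; first by rewrite subn0.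
case/andP=> h b; rewrite subnDA -IH //; last by apply: leq_trans qQ; exact: leq_subr.
congr (powT l u _).
have: (a == 0%N) || (size u + a < q)%N by [].
elim: a {h b} => [|a IHa] lt; first by rewrite subn0.
rewrite !iterS IHa; last by apply/orP; right; move: lt => /= lt; lia.
move: lt => /= lt.
have -> : (q - a = (q - a.+1).+1)%N by lia.
have E i : (i <= q - a.+1)%N -> R (l + i) (c (q - a.+1).+1) = c (q - a.+1)%N.
  by move=> le; apply: st => //; lia.
by rewrite TMl -?addnS ?E //; lia.
Qed.

Lemma iterR_cM l Q q e c f : zero_stable l Q c -> (e <= q <= Q)%N ->
  iter e (R l) (c q * f) = c (q - e)%N * iter e (R l) f.
Proof.
move=> st; elim: e => [|e IH] /andP[eq qQ]; first by rewrite subn0.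
rewrite !iterS IH ?(ltnW eq) // rmorphM /=; congr (_ * _).
have -> : (q - e = (q - e.+1).+1)%N by lia.
by have := @st (q - e.+1)%N 0%N; rewrite addn0; apply=> //; lia.
Qed.

Lemma gapT_cM l p u c f : zero_stable l p c -> ballot p u ->
  gapT l p u (c p * f) = c 0%N * gapT l p u f.
Proof.
move=> st b; rewrite /gapT (powT_cM _ st) // (iterR_cM _ st) ?leqnn ?leq_subr //.
by rewrite subnn.
Qed.

Lemma zero_stable_insert l p h : zero_stable l p (fun q => insert_gap l q h).
Proof. by move=> q i _ le; exact: insert_R. Qed.

Lemma zero_stable_qsymM l p g : all (leq 1) g -> zero_stable l p (fun q => qsymM l g q).
Proof. by move=> pg q i _ le; exact: qsymM_R. Qed.

Lemma gapT_insert l p u h f : ballot p u -> gapT l p u (insert_gap l p h * f) = h * gapT l p u f.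
Proof. by move=> b; rewrite (gapT_cM _ (@zero_stable_insert l p h)) // insert_0. Qed.

Lemma gapT_qsymM l p u g f : ballot p u -> all (leq 1) g -> g != [::] ->
  gapT l p u (qsymM l g p * f) = 0.
Proof.
move=> b pg ng; rewrite (gapT_cM _ (@zero_stable_qsymM l p g pg)) //.
by case: g pg ng => // c g _ _; rewrite qsymM_0 mul0r.
Qed.

Lemma powT_is_additive l u : {morph powT l u : f g / f + g}.
Proof.
elim: u => [|a u IH] f g //=; rewrite -IH; congr powT.
by elim: a => // a IHa; rewrite !iterS IHa raddfD.
Qed.

Lemma gapT_is_additive l p u : {morph gapT l p u : f g / f + g}.
Proof.
move=> f g; rewrite /gapT powT_is_additive; move: (powT l u f) (powT l u g) => {}f {}g.
by elim: (_ - _)%N => // e IH; rewrite !iterS IH raddfD.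
Qed.

Lemma additive0 (F : A -> A) : {morph F : f g / f + g} -> F 0 = 0.
Proof. by move=> FD; apply: (@addrI _ (F 0)); rewrite -FD !addr0. Qed.

Lemma T_Xn i b g : g \in PN i -> T i (x i ^+ b.+1 * g) = x i ^+ b * g.
Proof.
move=> gi; rewrite mulrC TMl ?(R_id _ gi) // 1?mulrC; congr (_ * _).
by apply: T_unique; rewrite -exprS !rmorphXn /= psR_lt // psR_eq expr0n subr0.
Qed.

Lemma iterT_Xn i b g : g \in PN i -> iter b (T i) (x i ^+ b * g) = g.
Proof.
move=> gi; elim: b => [|b IH]; first by rewrite expr0 mul1r.
by rewrite iterSr T_Xn.
Qed.

Lemma iterT_Xn_gt i a b g : g \in PN i -> (b < a)%N -> iter a (T i) (x i ^+ b * g) = 0.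
Proof.
move=> gi lt; rewrite -(subnK lt) addnS -addSn iterD iterT_Xn // iterSr T_eq0.
  by elim: (a - _)%N => // n; rewrite iterS => ->; rewrite raddf0.
by rewrite !(R_id _ gi).
Qed.

Lemma powT_xmon_id l u : powT l u (xmon l u) = 1.
Proof. by elim: u => //= a u IH; rewrite iterT_Xn // xmon_in. Qed.

(** Triangularity: T_i^a kills x_i^b for b < a, since the other factors do not involve x_i and
    x_(i+1). *)
Lemma powT_xmon_lt l u v : size u = size v -> lexlt v u -> powT l u (xmon l v) = 0.
Proof.
elim: u v => [|a u IH] [|b v] //= [e] /orP[ba|/andP[/eqP-> vu]].
  rewrite e iterT_Xn_gt ?xmon_in //; exact: (additive0 (powT_is_additive l u)).
by rewrite e iterT_Xn ?xmon_in // IH.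
Qed.

Lemma iterR_1 e l : iter e (R l) 1 = 1.
Proof. by elim: e => // e IH; rewrite iterS IH rmorph1. Qed.

Lemma gapT_xmon_id l p u h : ballot p u -> gapT l p u (xmon l u * insert_gap l p h) = h.
Proof. by move=> b; rewrite mulrC gapT_insert // /gapT powT_xmon_id iterR_1 mulr1. Qed.

Lemma gapT_xmon_lt l p u v h : ballot p u -> size u = size v -> lexlt v u ->
  gapT l p u (xmon l v * insert_gap l p h) = 0.
Proof.
move=> b e lt; rewrite mulrC gapT_insert // /gapT powT_xmon_lt //.
rewrite (_ : iter _ _ 0 = 0) ?mulr0 //.
by elim: (_ - _)%N => // n IH; rewrite iterS IH rmorph0.
Qed.

Fixpoint bounded_seqs b k : seq (seq nat) :=
  if k is k'.+1 then [seq a :: u | a <- iota 0 b.+1, u <- bounded_seqs b k'] else [:: [::]].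

Lemma bounded_seqsP b k u : reflect (size u = k /\ all (leq^~ b) u) (u \in bounded_seqs b k).
Proof.
elim: k u => [|k IH] u.
  by rewrite inE; apply: (iffP eqP) => [->|[/size0nil->]].
apply: (iffP (allpairsP (f := cons))) => [[[a v] [av /IH[sv vb] ->]]|[su ub]].
  by rewrite /= sv vb andbT; split=> //; move: av; rewrite mem_iota add0n ltnS.
case: u su ub => // a u [su] /= /andP[ab ub]; exists (a, u); split => //.
  by rewrite -[_ \in _]/(a \in iota 0 b.+1) mem_iota add0n ltnS.
by apply/IH.
Qed.

Lemma ballot_le q u : ballot q u -> all (leq^~ q) u.
Proof.
elim: u q => //= a u IH q /andP[h /IH le].
have -> : (a <= q)%N by case/orP: h => [/eqP->|]; lia.
by apply: sub_all le => i /= le; apply: leq_trans le (leq_subr _ _).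
Qed.

Definition lexle u v := (u == v) || lexlt u v.

Definition ballot_seqs p := sort lexle (undup [seq u <- bounded_seqs p p | ballot p u]).

Lemma mem_ballot_seqs p u : (u \in ballot_seqs p) = (size u == p) && ballot p u.
Proof.
rewrite mem_sort mem_undup mem_filter andbC; case: (boolP (ballot p u)) => b; rewrite ?andbF //.
by rewrite !andbT; apply/bounded_seqsP/eqP => [[]//|su]; split => //; exact: ballot_le.
Qed.

Lemma ballot_seqs_sorted p : pairwise lexlt (ballot_seqs p).
Proof.
have lelt : {in ballot_seqs p & &, transitive lexle}.
  move=> v u w _ _ _ /orP[/eqP->//|uv] /orP[/eqP<-|vw]; rewrite /lexle ?uv ?orbT //.
  by rewrite (lexlt_trans uv vw) orbT.
have tot : {in undup [seq u <- bounded_seqs p p | ballot p u] &, total lexle}.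
  move=> u v; rewrite !mem_undup !mem_filter.
  move=> /andP[_ /bounded_seqsP[su _]] /andP[_ /bounded_seqsP[sv _]].
  have := @lexlt_total u v; rewrite su sv /lexle (eq_sym v) => /(_ erefl).
  by case: (u == v); case: (lexlt u v); case: lexlt.
have uq : uniq (ballot_seqs p) by rewrite sort_uniq undup_uniq.
have srt : pairwise lexle (ballot_seqs p).
  rewrite -(sorted_pairwise_in lelt); last by apply/allP.
  by apply: (sort_sorted_in tot); apply/allP.
have : pairwise (fun u v => (u != v) && lexle u v) (ballot_seqs p).
  rewrite pairwise_relI srt andbT; by rewrite -uniq_pairwise.
by apply: sub_pairwise => u v /andP[ne /orP[/eqP e|//]]; rewrite e eqxx in ne.
Qed.

Section Peel.
Variables (l p : nat) (Phi : A -> A).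
Hypothesis PhiD : {morph Phi : f g / f + g}.
Hypothesis PhiM : forall g f, all (leq 1) g -> g != [::] -> Phi (qsymM l g p * f) = 0.

(** * Splitting off a gap *)

(** What is left of Phi after the components along the sequences in s are removed. *)
Definition remainder s (fam : seq nat -> A -> A) f : A :=
  Phi f - \sum_(u <- s) fam u (gapT l p u f).

(** The components are additive, take their values where Phi does, and keep each semilinearity
    of Phi with respect to a polynomial that does not involve the gap. *)
Definition inherits (fam : seq nat -> A -> A) :=
  [/\ forall u, {morph fam u : f g / f + g},
      forall c z, (forall f, Phi (insert_gap l p c * f) = z * Phi f) ->
        forall u f, fam u (c * f) = z * fam u f
    & forall n, (forall f, Phi f \in PN n) -> forall u f, fam u f \in PN n].

Lemma remainder_additive s fam : inherits fam -> {morph remainder s fam : f g / f + g}.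
Proof.
case=> FD _ _ f g; rewrite /remainder PhiD [RHS]addrACA -opprD -big_split; congr (_ - _).
by apply: eq_bigr => u _; rewrite gapT_is_additive FD.
Qed.

(** Gaussian elimination along the unitriangular system T^u (x^v): the component along u0 is read
    off at x^u0 after the lower ones have been removed, and its removal does not disturb the
    values at the lower monomials. *)
Lemma peel_ballots s : pairwise lexlt s -> all (fun u => (size u == p) && ballot p u) s ->
  exists2 fam, inherits fam &
    forall u h, u \in s -> remainder s fam (xmon l u * insert_gap l p h) = 0.
Proof.
elim/last_ind: s => [|s u0 IH].
  exists (fun _ _ => 0) => //; split => [u f g|c z _ u f|n _ u f]; rewrite ?addr0 ?mulr0 //.
  exact: In_0.
rewrite pairwise_rcons all_rcons => /andP[lts pws] /andP[/andP[/eqP su0 bu0] ok].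
rewrite -cats1.
have [fam inh vanish] := IH pws ok; case: (inh) => FD FM FI.
have ltu u : u \in s -> lexlt u u0.
  exact: (allP lts).
have nu0 : u0 \notin s by apply/negP => /ltu; rewrite lexlt_irr.
have CD := remainder_additive s inh.
pose fam' u g := if u == u0 then remainder s fam (xmon l u0 * insert_gap l p g) else fam u g.
exists fam'.
  split=> [u f g|c z Hc u f|n Hn u f]; rewrite /fam'; case: ifP => // _.
  - by rewrite rmorphD mulrDr CD.
  - exact: FD.
  - rewrite rmorphM mulrCA /remainder Hc mulrBr big_distrr /=; congr (_ - _).
    rewrite !big_seq; apply: eq_bigr => v /(allP ok) /andP[_ bv].
    by rewrite gapT_insert // (FM _ _ Hc).
  - exact: FM.
  - apply: In_B => //; apply: In_sum => v _; exact: FI.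
  - exact: FI.
have restE f : remainder (s ++ [:: u0]) fam' f = remainder s fam f - fam' u0 (gapT l p u0 f).
  rewrite /remainder big_cat big_seq1 opprD addrA; congr (_ - _ - _).
  rewrite !big_seq; apply: eq_bigr => u us; rewrite /fam' ifN //.
  by apply: contraNneq nu0 => <-.
have F0 : fam' u0 0 = 0 by rewrite /fam' eqxx rmorph0 mulr0 (additive0 CD).
move=> u h; rewrite mem_cat inE restE => /orP[us|/eqP->].
  rewrite gapT_xmon_lt ?F0 ?subr0 ?vanish ?ltu //.
  by rewrite su0; have /andP[/eqP] := allP ok _ us.
by rewrite gapT_xmon_id // /fam' eqxx subrr.
Qed.

(** A map killed by the quasisymmetric polynomials of a gap factors through the maps that remove
    the gap: by [straightening], nothing is left after the elimination over all ballot
    sequences. *)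
Lemma gap_decomposition : exists2 fam, inherits fam &
  forall f, Phi f = \sum_(u <- ballot_seqs p) fam u (gapT l p u f).
Proof.
have okb : all (fun u => (size u == p) && ballot p u) (ballot_seqs p).
  by apply/allP => u; rewrite mem_ballot_seqs.
have [fam inh vanish] := peel_ballots (ballot_seqs_sorted p) okb.
exists fam => // f; apply/eqP; rewrite -subr_eq0; apply/eqP.
apply: (@straightening _ l p (remainder (ballot_seqs p) fam) (remainder_additive _ inh))
  => [g f' pg ng|u h su bu].
  rewrite /remainder PhiM // sub0r big_seq big1 ?oppr0 // => u /(allP okb)/andP[_ bu].
  by rewrite gapT_qsymM //; case: inh => FD _ _; rewrite (additive0 (FD u)).
by apply: vanish; rewrite mem_ballot_seqs su eqxx.
Qed.
End Peel.

(** * The span of the words in R_0 and the T_i *)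

(** The maps Pol_(r+k) -> Pol_r that are Pol_r-linear combinations of products of k operators
    R_0 or T_i. They are built from the right, so that precomposition with one more operator is
    immediate; only the values on Pol_(r+k) count. *)
Inductive wspan r : nat -> (A -> A) -> Prop :=
| wspan_mul c Phi : c \in PN r -> (forall f, f \in PN r -> Phi f = c * f) -> wspan r 0 Phi
| wspan_R k Psi Phi : wspan r k Psi -> (forall f, f \in PN (r + k).+1 -> Phi f = Psi (R 0 f)) ->
    wspan r k.+1 Phi
| wspan_T k i Psi Phi : (i < r + k)%N -> wspan r k Psi ->
    (forall f, f \in PN (r + k).+1 -> Phi f = Psi (T i f)) -> wspan r k.+1 Phi
| wspan_0 k Phi : (forall f, f \in PN (r + k) -> Phi f = 0) -> wspan r k Phi
| wspan_D k Psi1 Psi2 Phi : wspan r k Psi1 -> wspan r k Psi2 ->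
    (forall f, f \in PN (r + k) -> Phi f = Psi1 f + Psi2 f) -> wspan r k Phi.

Lemma wspan_ext r k Psi Phi : wspan r k Psi ->
  (forall f, f \in PN (r + k) -> Phi f = Psi f) -> wspan r k Phi.
Proof.
move=> SP e; apply: (@wspan_D _ _ _ (fun _ => 0) _ SP) => [|f fn]; first exact: wspan_0.
by rewrite e // addr0.
Qed.

Lemma wspan_sum r k (I : eqType) (s : seq I) (F : I -> A -> A) :
  (forall i, i \in s -> wspan r k (F i)) -> wspan r k (fun f => \sum_(i <- s) F i f).
Proof.
elim: s => [|i s IH] H; first by apply: wspan_0 => f _; rewrite big_nil.
have Si := H i (mem_head i s).
apply: (wspan_D Si (IH _)) => [j js|f _]; last by rewrite big_cons.
by apply: H; rewrite inE js orbT.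
Qed.

Lemma wspan_scale r k z Psi : z \in PN r -> wspan r k Psi -> wspan r k (fun f => z * Psi f).
Proof.
move=> zr; elim=> {k Psi} [c Phi cr e|k Psi Phi _ IH e|k i Psi Phi ik _ IH e|k Phi e
  |k P1 P2 Phi _ I1 _ I2 e].
- by apply: (@wspan_mul _ (z * c)) => [|f fr]; [exact: In_M | rewrite e // mulrA].
- by apply: (wspan_R IH) => f fn; rewrite e.
- by apply: (wspan_T ik IH) => f fn; rewrite e.
- by apply: wspan_0 => f fn; rewrite e // mulr0.
- by apply: (wspan_D I1 I2) => f fn; rewrite e // mulrDr.
Qed.

Lemma wspan_additive r k Psi f g : wspan r k Psi -> f \in PN (r + k) -> g \in PN (r + k) ->
  Psi (f + g) = Psi f + Psi g.
Proof.
move=> SP; elim: SP f g => {k Psi} [c Phi cr e|k Psi Phi _ IH e|k i Psi Phi ik _ IH e|k Phi e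
  |k P1 P2 Phi _ I1 _ I2 e] f g fn gn.
- by rewrite addn0 in fn gn; rewrite !e ?In_D // mulrDr.
- rewrite addnS in fn gn; rewrite !e ?In_D // raddfD IH //; exact: R_in.
- rewrite addnS in fn gn; rewrite !e ?In_D // raddfD IH //; exact: T_in.
- by rewrite !e ?In_D // addr0.
- by rewrite !e ?In_D // I1 // I2 // addrACA.
Qed.

Lemma wspan_sumf r k Psi (s : seq nat) (F : nat -> A) : wspan r k Psi ->
  (forall i, i \in s -> F i \in PN (r + k)) ->
  Psi (\sum_(i <- s) F i) = \sum_(i <- s) Psi (F i).
Proof.
move=> SP; have P0 : Psi 0 = 0.
  by apply: (@addrI _ (Psi 0)); rewrite -(wspan_additive SP) ?addr0 // In_0.
elim: s => [|i s IH] H; first by rewrite !big_nil.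
have Hs j : j \in s -> F j \in PN (r + k) by move=> js; apply: H; rewrite inE js orbT.
rewrite !big_cons (wspan_additive SP) ?IH //; first by apply: H; rewrite inE eqxx.
by rewrite big_seq; apply: In_sum.
Qed.

(** The telescoping sum [R_T_sum] brings in the variables x_j as factors; they are handled by the
    hypothesis that Psi can be precomposed with multiplications, which [wspan_premul] proves by
    induction with the help of this very lemma. *)
Lemma wspan_MR r k l c Psi : wspan r k Psi -> c \in PN (r + k) -> (l <= r + k)%N ->
  (forall d, d \in PN (r + k) -> wspan r k (fun f => Psi (d * f))) ->
  wspan r k.+1 (fun f => Psi (c * R l f)).
Proof.
move=> SP cn ln H.
have xn j : j \in iota 0 l -> c * x j \in PN (r + k).
  by rewrite mem_iota => /= jl; apply: In_M => //; apply: psIn_X; lia.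
have SPs : wspan r k.+1 (fun f => \sum_(j <- iota 0 l) Psi (c * x j * T j f)).
  have : {subset iota 0 l <= iota 0 l} by [].
  elim: {1 3}(iota 0 l) => [|j s IH] sub; first by apply: wspan_0 => f _; rewrite big_nil.
  have jl : j \in iota 0 l by apply: sub; rewrite inE eqxx.
  have Sj : wspan r k.+1 (fun f => Psi (c * x j * T j f)).
    apply: (@wspan_T r k j _ _ _ (H _ (xn _ jl))) => //.
    by move: jl; rewrite mem_iota => /= jl; exact: leq_trans jl ln.
  have Ss := IH (fun i h => sub i (mem_behead (s := j :: s) h)).
  by apply: (wspan_D Sj Ss) => f _; rewrite big_cons.
apply: (wspan_D (wspan_R (H _ cn) (fun _ _ => erefl)) SPs) => f; rewrite addnS => fn.
have jn j : j \in iota 0 l -> c * x j * T j f \in PN (r + k).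
  move=> jl; apply: In_M; first exact: xn.
  by apply: T_in => //; move: jl; rewrite mem_iota => /= jl; exact: leq_trans jl ln.
rewrite R_T_sum mulrDr -(big_mkord xpredT (fun i => x i * T i f)) /index_iota subn0.
rewrite big_distrr /=.
rewrite (eq_bigr (fun j => c * x j * T j f)); last by move=> j _; rewrite mulrA.
rewrite (wspan_additive SP) ?(wspan_sumf SP) //; first by apply: In_M => //; exact: R_in.
by rewrite big_seq; apply: In_sum.
Qed.

(** The span is also a right module, because the Leibniz rule moves factors to the left. *)
Lemma wspan_premul r k c Psi : c \in PN (r + k) -> wspan r k Psi -> wspan r k (fun f => Psi (c * f)).
Proof.
move=> cn SP; elim: SP c cn => {k Psi} [d Phi dr e|k Psi Phi SP IH e|k i Psi Phi ik SP IH e|k Phi e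
  |k P1 P2 Phi _ I1 _ I2 e] c cn.
- rewrite addn0 in cn; apply: (@wspan_mul _ (d * c)) => [|f fr]; first exact: In_M.
  by rewrite e ?mulrA //; exact: In_M.
- rewrite addnS in cn; apply: (wspan_R (IH (R 0 c) _)) => [|f fn]; first exact: R_in.
  by rewrite e ?rmorphM //; exact: In_M.
- rewrite addnS in cn.
  have R1 : R i.+1 c \in PN (r + k) by exact: R_in.
  have T1 : T i c \in PN (r + k) by exact: T_in.
  have S1 : wspan r k.+1 (fun f => Psi (R i.+1 c * T i f)) by exact: (wspan_T ik (IH _ R1)).
  have S2 := wspan_MR SP T1 (ltnW ik) IH.
  apply: (wspan_D S1 S2) => f; rewrite addnS => fn.
  rewrite e; last exact: In_M.
  rewrite TM (wspan_additive SP) //; apply: In_M => //; first exact: T_in.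
  by apply: R_in => //; exact: ltnW.
- by apply: wspan_0 => f fn; rewrite e //; exact: In_M.
- by apply: (wspan_D (I1 _ cn) (I2 _ cn)) => f fn; rewrite e //; exact: In_M.
Qed.

Lemma wspan_Rl r k l Psi : (l <= r + k)%N -> wspan r k Psi -> wspan r k.+1 (fun f => Psi (R l f)).
Proof.
move=> le SP; apply: (@wspan_ext r k.+1 (fun f => Psi (1 * R l f))); last by move=> f _; rewrite mul1r.
by apply: wspan_MR; rewrite ?In_1 // => d dn; exact: wspan_premul.
Qed.

Lemma wspan_iterT r k i a Psi : (i < r + k)%N -> wspan r k Psi ->
  wspan r (k + a) (fun f => Psi (iter a (T i) f)).
Proof.
move=> ik SP; elim: a => [|a IH]; first by rewrite addn0; exact: wspan_ext SP _.
rewrite addnS; apply: (@wspan_T _ _ i _ _ _ IH) => [|f _]; first by rewrite addnA ltn_addr.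
by rewrite iterSr.
Qed.

Lemma wspan_iterR r k l e Psi : (l <= r + k)%N -> wspan r k Psi ->
  wspan r (k + e) (fun f => Psi (iter e (R l) f)).
Proof.
move=> lk SP; elim: e => [|e IH]; first by rewrite addn0; exact: wspan_ext SP _.
rewrite addnS; apply: (wspan_ext (@wspan_Rl _ _ l _ _ IH)) => [|f _].
  by rewrite addnA (leq_trans lk) // leq_addr.
by rewrite iterSr.
Qed.

Lemma wspan_powT r k l q u Psi : ballot q u -> wspan r k Psi -> (l + q <= r + k + sumn u)%N ->
  wspan r (k + sumn u) (fun f => Psi (powT l u f)).
Proof.
elim: u q => [|a u IH] q /=; first by rewrite !addn0 => _ SP _; exact: wspan_ext SP _.
case/andP=> h b SP le.
have SQ : wspan r (k + sumn u) (fun f => Psi (powT l u f)) by apply: IH b SP _; lia.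
case: (posnP a) => [->|a0]; first by rewrite add0n.
rewrite (addnC a) addnA; apply: wspan_iterT SQ.
by case/orP: h => [/eqP|lt]; lia.
Qed.

Lemma wspan_gapT r k l p u Psi : (l <= r + k)%N -> ballot p u -> wspan r k Psi ->
  wspan r (k + p) (fun f => Psi (gapT l p u f)).
Proof.
move=> lk b SP; have su := ballot_sumn b.
have -> : (k + p = k + (p - sumn u) + sumn u)%N by lia.
by apply: (wspan_powT b (wspan_iterR _ lk SP)); lia.
Qed.
End Gap.

Section Main.
Variable S : polySystem.
Local Notation A := (@psRing S).
Local Notation x := (@psX S).
Local Notation R := (@psR S).
Local Notation T := (@psT S).
Local Notation PN := (@psIn S).
Local Notation qsymM := (@qsymM S).
Local Notation xmon := (@xmon S).
Local Notation insert_gap := (@insert_gap S).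
Local Notation gapT := (@gapT S).
Local Notation wspan := (@wspan S).

(** * Isolating the lowest surviving variable *)

(** A set of variables is encoded by a sequence of booleans; [powmask] gives each of its elements
    the exponent N. *)
Definition powmask N (mk : seq bool) := [seq (N * nat_of_bool b)%N | b <- mk].

(** The ideal generated by the products of the N-th powers of s distinct variables among
    x_l, ..., x_(l+m-1). *)
Inductive fat l m N s : A -> Prop :=
| fat0 : fat l m N s 0
| fatD g1 g2 : fat l m N s g1 -> fat l m N s g2 -> fat l m N s (g1 + g2)
| fatM mk h : size mk = m -> (s <= count id mk)%N -> fat l m N s (xmon l (powmask N mk) * h).

Lemma fat_mul l m N s g h : fat l m N s g -> fat l m N s (g * h).
Proof.
elim=> [|g1 g2 _ I1 _ I2|mk h' sm cm]; first by rewrite mul0r; exact: fat0.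
  by rewrite mulrDl; exact: fatD.
by rewrite -mulrA; exact: fatM.
Qed.

Lemma fat_le l m N s s' g : (s' <= s)%N -> fat l m N s g -> fat l m N s' g.
Proof.
move=> le; elim=> [|g1 g2 _ I1 _ I2|mk h' sm cm]; [exact: fat0|exact: fatD|].
by apply: fatM => //; exact: leq_trans cm.
Qed.

Lemma fat_1 l m N : fat l m N 0 1.
Proof.
have -> : 1 = xmon l (powmask N (nseq m false)) * 1 :> A.
  by rewrite mulr1 /powmask map_nseq muln0 xmon0.
by apply: fatM; rewrite ?size_nseq.
Qed.

Lemma fat_cat l p m N s1 s2 g1 g2 : fat l p N s1 g1 -> fat (l + p) m N s2 g2 ->
  fat l (p + m) N (s1 + s2) (g1 * g2).
Proof.
move=> F1 F2; elim: F1 => [|g g' _ I1 _ I2|mk h sm cm]; first by rewrite mul0r; exact: fat0.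
  by rewrite mulrDl; exact: fatD.
elim: F2 => [|g g' _ I1 _ I2|mk' h' sm' cm']; first by rewrite mulr0; exact: fat0.
  by rewrite mulrDr; exact: fatD.
have -> : xmon l (powmask N mk) * h * (xmon (l + p) (powmask N mk') * h') =
    xmon l (powmask N (mk' ++ mk)) * (h * h').
  by rewrite /powmask map_cat xmon_cat size_map sm; ring.
by apply: fatM; rewrite ?size_cat ?count_cat ?sm ?sm' addnC // leq_add.
Qed.

Lemma fat_X l N c : (N <= c)%N -> fat l 1 N 1 (x l ^+ c).
Proof.
move=> le; have -> : x l ^+ c = xmon l (powmask N [:: true]) * x l ^+ (c - N).
  by rewrite /= muln1 addn0 mulr1 -exprD subnKC.
exact: fatM.
Qed.

Lemma fat_S l m N s g : fat l m N s g -> fat l m.+1 N s g.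
Proof.
by move=> F; rewrite -addn1 -[s]addn0 -[g]mulr1; apply: fat_cat => //; exact: fat_1.
Qed.

Lemma fat_SX l m N s g c : (N <= c)%N -> fat l m N s g ->
  fat l m.+1 N s.+1 (x (l + m) ^+ c * g).
Proof.
move=> le F; rewrite -addn1 -(addn1 s) mulrC; apply: fat_cat => //; exact: fat_X.
Qed.

(** Each term of a monomial quasisymmetric polynomial carries its parts on distinct variables. *)
Lemma fat_qsymM l m N b : fat l m N (count (leq N) b) (qsymM l b m).
Proof.
elim: m b => [|m IH] [|c b]; rewrite ?qsymM_nil ?qsymM_0; try exact: fat_1.
  exact: fat0.
rewrite qsymM_S; apply: fatD; first exact/fat_S/IH.
rewrite /=; case: leqP => cN; first exact/fat_SX/IH.
by rewrite add0n mulrC; apply/fat_mul/fat_S/IH.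
Qed.

(** Two distinct sets with s elements have at least s + 1 elements in their union: of the terms
    of the quasisymmetric polynomial with s parts N, only the one carried by the set itself
    remains after multiplication by the N-th powers of its elements, up to terms with s + 1 large
    exponents. *)
Lemma fat_square l N mk s : count id mk = s -> fat l (size mk) N s.+1
  (xmon l (powmask N mk) * qsymM l (nseq s N) (size mk) - xmon l (powmask (N + N) mk)).
Proof.
elim: mk s => [|[] mk IH] s /=.
- case: s => // _; rewrite /= qsymM_nil mulr1 subrr; exact: fat0.
- case: s => // s []; rewrite !add0n => cs; rewrite !muln1 qsymM_S !size_map.
  set xx := x _; set M1 := xmon _ _; set M2 := xmon _ _.
  have -> : xx ^+ N * M1 * (qsymM l (N :: nseq s N) (size mk) + xx ^+ N * qsymM l (nseq s N) (size mk))
      - xx ^+ (N + N) * M2 =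
    xx ^+ N * qsymM l (nseq s.+1 N) (size mk) * M1 +
    xx ^+ (N + N) * (M1 * qsymM l (nseq s N) (size mk) - M2) by rewrite exprD /=; ring.
  apply: fatD.
    apply: fat_mul; apply: fat_SX => //.
    by apply: fat_le (fat_qsymM _ _ _ _); rewrite count_nseq leqnn mul1n.
  by apply: fat_SX; [exact: leq_addr | exact: IH].
- rewrite add0n => cs; rewrite !muln0 !expr0 !mul1r.
  case: s cs => [|s] cs.
    by rewrite qsymM_nil -(qsymM_nil S l (size mk)); apply: fat_S; exact: IH.
  rewrite qsymM_S mulrDr addrAC; apply: fatD; first by apply: fat_S; exact: IH.
  rewrite mulrCA mulrA; apply: fat_mul; apply: fat_SX => //.
  by rewrite -[xmon _ _]mulr1; apply: fatM => //; rewrite cs.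
Qed.

(** Semilinearity with respect to the quasisymmetric polynomials in the a variables from x_l on,
    which act on the target through its b variables from x_l on. *)
Definition qsym_semilinear l a b (Phi : A -> A) :=
  forall g f, all (leq 1) g -> Phi (qsymM l g a * f) = qsymM l g b * Phi f.

(** More than b large exponents are too many for the target. By descending induction on the
    number s > b of large exponents: the quasisymmetric polynomial with s parts N acts as zero,
    and by [fat_square] its product with the N-th powers of s variables is, up to terms with more
    large exponents, the product of their 2N-th powers. *)
Lemma fat_kill l a b Phi : {morph Phi : f g / f + g} -> qsym_semilinear l a b Phi ->
  exists2 N, (0 < N)%N & forall g f, fat l a N b.+1 g -> Phi (g * f) = 0.
Proof.
move=> PD PM; have P0 := additive0 PD.
have PN f : Phi (- f) = - Phi f by apply: (@addrI _ (Phi f)); rewrite -PD !subrr P0.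
suff H d s : (a < s + d)%N -> (b < s)%N ->
    exists2 N, (0 < N)%N & forall g f, fat l a N s g -> Phi (g * f) = 0.
  by apply: (H a); [rewrite addSn ltnS leq_addl | ].
elim: d s => [|d IH] s asd bs.
  exists 1%N => // g f; elim=> [|g1 g2 _ I1 _ I2|mk h sm cm]; rewrite ?mul0r //.
    by rewrite mulrDl PD I1 I2 addr0.
  by have := count_size id mk; lia.
have [||N N0 HN] := IH s.+1; [lia|exact: ltnW|].
(* a product of (2N)-th powers is the square that [fat_square] compares with *)
exists (N + N)%N; first by rewrite addn_gt0 N0.
move=> g f; elim=> [|g1 g2 _ I1 _ I2|mk h sm cm]; rewrite ?mul0r //.
  by rewrite mulrDl PD I1 I2 addr0.
have pow2 : xmon l (powmask (N + N) mk) = xmon l (powmask N mk) * xmon l (powmask N mk).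
  rewrite xmon_mul //; congr xmon; rewrite /add_exponents /powmask.
  by elim: mk {sm cm} => //= t mk <-; rewrite mulnDl.
case: (ltngtP s (count id mk)) cm => // [lt _|e _].
  by rewrite pow2 -!mulrA; apply: HN; rewrite -[xmon _ _]mulr1; exact: fatM.
have := fat_square l N (esym e); rewrite sm => F.
have := HN _ (h * f) F.
rewrite mulrBl PD PN -(mulrA _ h) => /eqP; rewrite subr_eq0 => /eqP<-.
rewrite (_ : xmon l (powmask N mk) * qsymM l (nseq s N) a * (h * f) =
  qsymM l (nseq s N) a * (xmon l (powmask N mk) * h * f)); last by ring.
rewrite PM ?qsymM_gt ?mul0r ?size_nseq //.
by rewrite all_nseq N0 orbT.
Qed.

Definition xprod r : A := \prod_(i < r) x i.

Lemma xprod_in r : xprod r \in PN r.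
Proof.
rewrite /xprod; elim/big_ind: _ => [|f g|i _]; [exact: In_1|exact: In_M|exact: psIn_X].
Qed.

(** Membership in the span after the variables of the target are inverted. *)
Definition locspan r k Phi := exists N, wspan r k (fun f => xprod r ^+ N * Phi f).

Lemma locspan_raise r k Phi n : locspan r k (fun f => xprod r ^+ n * Phi f) -> locspan r k Phi.
Proof.
case=> N SP; exists (N + n)%N; apply: (wspan_ext SP) => f _.
by rewrite exprD mulrA.
Qed.

Lemma locspan_sum r k (I : eqType) (s : seq I) (F : I -> A -> A) :
  (forall i, i \in s -> locspan r k (F i)) -> locspan r k (fun f => \sum_(i <- s) F i f).
Proof.
elim: s => [|i s IH] H.
  by exists 0%N; apply: wspan_0 => f _; rewrite big_nil mulr0.
have [N1 S1] := H i (mem_head i s).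
have [|N2 S2] := IH; first by move=> j js; apply: H; rewrite inE js orbT.
exists (N1 + N2)%N.
have inD n : xprod r ^+ n \in PN r by apply/In_Xn/xprod_in.
apply: (wspan_D (wspan_scale (inD N2) S1) (wspan_scale (inD N1) S2)) => f _.
by rewrite big_cons exprD; ring.
Qed.

Lemma locspan_ext r k Psi Phi : locspan r k Psi -> (forall f, Phi f = Psi f) -> locspan r k Phi.
Proof. by case=> N SP e; exists N; apply: (wspan_ext SP) => f _; rewrite e. Qed.

Lemma locspan_scale r k z Psi : z \in PN r -> locspan r k Psi -> locspan r k (fun f => z * Psi f).
Proof.
move=> zr [N SP]; exists N; apply: (wspan_ext (wspan_scale zr SP)) => f _; exact: mulrCA.
Qed.

(** The terms are sorted by the variable that carries the first part. *)
Lemma qsymM_rcons l g c m : qsymM l (rcons g c) m =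
  \sum_(p < m) x (l + p) ^+ c * qsymM (l + p.+1) g (m - p.+1)%N.
Proof.
elim: m g => [|m IH] g; first by rewrite big_ord0; case: g.
case: g => [|d g] /=.
  rewrite qsymM_S (IH [::]) [RHS]big_ord_recr /= !qsymM_nil !mulr1; congr (_ + _).
  by apply: eq_bigr => i _; rewrite !qsymM_nil.
rewrite qsymM_S (IH (d :: g)) IH [RHS]big_ord_recr /= subnn qsymM_0 mulr0 addr0 big_distrr -big_split /=.
apply: eq_bigr => i _; rewrite subSn // qsymM_S (_ : l + i.+1 + _ = l + m)%N; last first.
  by have := ltn_ord i; lia.
by ring.
Qed.

Lemma qsymM_low l g c : qsymM l (rcons g c) (size g).+1 = x l ^+ c * qsymM l.+1 g (size g).
Proof.
elim: g => [|d g IH] /=; first by rewrite qsymM_S qsymM_0 !qsymM_nil add0r addn0.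
rewrite -(size_rcons g c) qsymM_size size_rcons IH qsymM_size mulrCA addnS addSn.
by [].
Qed.

Lemma qsymM_nseq l n N : qsymM l (nseq n N) n = \prod_(i < n) x (l + i) ^+ N.
Proof.
elim: n => [|n IH]; first by rewrite big_ord0 qsymM_nil.
by have := @qsymM_size S l N (nseq n N); rewrite size_nseq big_ord_recr /= => ->; rewrite IH mulrC.
Qed.

Lemma xprod_qsymM l n N : xprod (l + n) ^+ N = xprod l ^+ N * qsymM l (nseq n N) n.
Proof.
rewrite /xprod qsymM_nseq -!prodrXl.
by rewrite big_split_ord.
Qed.

(** Here the source has p + 1 + m variables from x_l on and the target has b + 1 of them. The
    piece attached to p collects the sets s whose lowest element is x_(l+p): below it lies a gap
    of p variables, and the b other elements of s are among the m variables above. *)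
Section Piece.
Variables (l p m b N : nat) (Phi : A -> A).
Hypotheses (N0 : (0 < N)%N) (PhiD : {morph Phi : f g / f + g}).
Hypothesis PhiM : qsym_semilinear l (p.+1 + m) b.+1 Phi.
Hypothesis kill : forall g f, fat l (p.+1 + m) N b.+2 g -> Phi (g * f) = 0.

Definition upper := qsymM (l + p.+1) (nseq b N) m.
Definition localizer := x (l + p) ^+ N * upper.
Definition piece f := Phi (localizer * f).

Lemma fat_split s1 s2 c g1 g2 : (N <= c)%N -> fat l p N s1 g1 -> fat (l + p.+1) m N s2 g2 ->
  fat l (p.+1 + m) N (s1.+1 + s2) (x (l + p) ^+ c * g1 * g2).
Proof. by move=> Nc F1 F2; apply: fat_cat => //; exact: fat_SX. Qed.

Lemma upper_fat : fat (l + p.+1) m N b upper.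
Proof. by apply: fat_le (fat_qsymM _ _ _ _); rewrite count_nseq leqnn mul1n. Qed.

Lemma pieceD : {morph piece : f g / f + g}.
Proof. by move=> f g; rewrite /piece mulrDr PhiD. Qed.

Lemma pieceM : qsym_semilinear l (p.+1 + m) b.+1 piece.
Proof. by move=> g f pg; rewrite /piece mulrCA PhiM. Qed.

Lemma piece_lower s g f : fat l p N s.+1 g -> piece (g * f) = 0.
Proof.
move=> F; rewrite /piece (_ : _ * _ = x (l + p) ^+ N * g * upper * f); last first.
  by rewrite /localizer; ring.
apply: kill; apply: (fat_le _ (fat_split (leqnn N) F upper_fat)); lia.
Qed.

Lemma piece_upper g f : fat (l + p.+1) m N b.+1 g -> piece (g * f) = 0.
Proof.
move=> F; rewrite /piece (_ : _ * _ = x (l + p) ^+ N * 1 * g * (upper * f)); last first.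
  by rewrite /localizer; ring.
apply: kill; apply: (fat_le _ (fat_split (leqnn N) (fat_1 _ _ _) F)); lia.
Qed.

Lemma piece_sum (I : Type) (s : seq I) (F : I -> A) :
  piece (\sum_(i <- s) F i) = \sum_(i <- s) piece (F i).
Proof. by apply: (big_morph piece pieceD); rewrite (additive0 pieceD). Qed.

(** In a quasisymmetric polynomial with b + 1 large parts, the last b of them together with the
    large exponents of the piece would be too many unless they are carried by the variables above
    x_(l+p), and the first large part by x_(l+p) itself. Hence the parts that precede it sit in
    the gap. *)
Lemma piece_cat C c g f : size C = b -> all (leq N) C -> (N <= c)%N ->
  piece (qsymM l (C ++ c :: g) (p.+1 + m) * f) =
  piece (qsymM (l + p.+1) C m * x (l + p) ^+ c * qsymM l g p * f).
Proof.
move=> sC NC Nc; rewrite qsymM_cat big_distrl piece_sum /=.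
have lt : (b < (size (C ++ c :: g)).+1)%N by rewrite size_cat sC; lia.
rewrite (bigD1 (Ordinal lt)) //= (take_size_cat _ sC) (drop_size_cat _ sC) big1.
  rewrite addr0 qsymM_S (_ : _ * _ = qsymM l (c :: g) p * (qsymM (l + p.+1) C m * f) +
    qsymM (l + p.+1) C m * x (l + p) ^+ c * qsymM l g p * f); last by ring.
  rewrite pieceD (@piece_lower 0) ?add0r //.
  by apply: fat_le (fat_qsymM _ _ _ _); rewrite /= Nc.
move=> i ne; case: (ltnP i b) => [ib|bi].
  rewrite drop_cat sC ib.
  have : (0 < size (drop i C))%N by rewrite size_drop sC subn_gt0.
  case: (drop i C) => // d D _ /=; rewrite qsymM_S.
  rewrite (_ : _ * _ = qsymM l (d :: D ++ c :: g) p * (qsymM (l + p.+1) (take i (C ++ c :: g)) m * f) +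
    qsymM l (D ++ c :: g) p * (x (l + p) ^+ d * qsymM (l + p.+1) (take i (C ++ c :: g)) m * f));
    last by ring.
  rewrite pieceD !(@piece_lower 0) ?addr0 //; apply: fat_le (fat_qsymM _ _ _ _);
    by rewrite /= ?count_cat /= Nc ?addnS.
rewrite -mulrA; apply: piece_upper; apply: fat_le (fat_qsymM _ _ _ _).
have bi' : (b < i)%N by rewrite ltn_neqAle bi andbT; apply: contraNneq ne => e; apply/eqP/val_inj.
rewrite take_cat sC ifN -?leqNgt //.
have : (0 < i - b)%N by rewrite subn_gt0.
case: (i - b)%N => // j _; rewrite /= count_cat /= Nc; move: NC; rewrite all_count sC => /eqP->; lia.
Qed.

(** Without further parts, the surviving term acts as an invertible scalar, up to localization. *)
Lemma piece_unit f c : (N <= c)%N ->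
  piece (upper * x (l + p) ^+ c * f) = qsymM l (rcons (nseq b N) c) b.+1 * piece f.
Proof.
move=> Nc; rewrite -pieceM; last by rewrite all_rcons all_nseq N0 orbT (leq_trans N0).
rewrite -cats1 piece_cat ?size_nseq // ?qsymM_nil ?mulr1 //.
by rewrite all_nseq leqnn orbT.
Qed.

Lemma rcons_nseq_inj c : injective ( *%R (qsymM l (rcons (nseq b N) c) b.+1)).
Proof. by have := @qsymM_size_inj S l (rcons (nseq b N) c); rewrite size_rcons size_nseq. Qed.

(** One more part makes the composition too long for the target, so that the product of a scalar
    which is not a zero divisor with the left-hand side vanishes. *)
Lemma piece_gap g f : all (leq 1) g -> g != [::] -> piece (qsymM l g p * f) = 0.
Proof.
move=> pg ng; apply: (@rcons_nseq_inj N); rewrite mulr0 -piece_unit // mulrA.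
rewrite -piece_cat ?size_nseq // ?all_nseq ?leqnn ?orbT //.
rewrite pieceM ?qsymM_gt ?mul0r //; first by rewrite size_cat size_nseq /=; case: g pg ng => //= *; lia.
by rewrite all_cat all_nseq /= N0 orbT pg.
Qed.

(** Compare the compositions whose first large parts are N and N + 1. *)
Lemma piece_X f : piece (x (l + p) * f) = x l * piece f.
Proof.
apply: (@rcons_nseq_inj N); rewrite -piece_unit // mulrA -mulrA.
rewrite (_ : _ * _ = upper * x (l + p) ^+ N.+1 * f); last by rewrite exprSr; ring.
rewrite piece_unit // mulrA; congr (_ * _).
by have := @qsymM_low l (nseq b N); rewrite size_nseq => E; rewrite !E exprSr; ring.
Qed.

Lemma piece_block g f : all (leq 1) g -> piece (qsymM l g p.+1 * f) = qsymM l g 1 * piece f.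
Proof.
case: g => [|e g] pg; first by rewrite !qsymM_nil !mul1r.
case/andP: (pg) => e0 pg'; rewrite !qsymM_S qsymM_0 add0r addn0 mulrDl pieceD piece_gap // add0r.
have X n h : piece (x (l + p) ^+ n * h) = x l ^+ n * piece h.
  by elim: n h => [|n IH] h; rewrite ?expr0 ?mul1r // !exprSr -!mulrA IH piece_X.
rewrite -mulrA X -mulrA; congr (_ * _).
case: g pg' {pg} => [|d g] pg'; first by rewrite !qsymM_nil !mul1r.
by rewrite piece_gap // qsymM_0 mul0r.
Qed.

(** Now that the action of the gap and of x_(l+p) is known, the coproduct determines the action
    of the quasisymmetric polynomials in the variables above, by induction on the length. *)
Lemma piece_tail g f : all (leq 1) g ->
  piece (qsymM (l + p.+1) g m * f) = qsymM l.+1 g b * piece f.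
Proof.
have [n] := ubnP (size g); elim: n g f => // n IH g f ltn pg.
have := pieceM f pg; rewrite -(add1n b) !qsymM_cat !big_distrl piece_sum /= addn1.
rewrite !big_ord_recr /= !take_size !drop_size !qsymM_nil !mulr1.
rewrite (eq_bigr (fun i : 'I_(size g) => qsymM l.+1 (take i g) b * qsymM l (drop i g) 1 * piece f)).
  by move/addrI.
move=> i _; have pt : all (leq 1) (take i g) by apply/allP => j /mem_take /(allP pg).
have pd : all (leq 1) (drop i g) by apply/allP => j /mem_drop /(allP pg).
rewrite -mulrA IH //; first by rewrite piece_block // mulrA.
by rewrite size_take ltn_ord; apply: leq_trans (ltn_ord i) _.
Qed.
End Piece.

(** * The homomorphisms after localization *)

(** A homomorphism whose first l variables have already been identified with those of the target,
    with a source variables and b target variables left. *)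
Definition partial_hom l a b (Phi : A -> A) :=
  [/\ {morph Phi : f g / f + g}, forall f, Phi f \in PN (l + b),
      forall i f, (i < l)%N -> Phi (x i * f) = x i * Phi f & qsym_semilinear l a b Phi].

Lemma additive_int (F : A -> A) (c : int) h : {morph F : f g / f + g} ->
  F (c%:~R * h) = c%:~R * F h.
Proof.
move=> FD; have F0 := additive0 FD.
have FN f : F (- f) = - F f by apply: (@addrI _ (F f)); rewrite -FD !subrr F0.
have Fn n : F (n%:R * h) = n%:R * F h.
  by elim: n => [|n IH]; rewrite ?mul0r // !mulrS !mulrDl !mul1r FD IH.
case: c => n; first exact: Fn.
by rewrite NegzE !mulrNz !mulNr FN Fn.
Qed.

Lemma frozen_wspan l Phi : partial_hom l 0 0 Phi -> wspan l 0 Phi.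
Proof.
case=> FD FI FX _; rewrite !addn0 in FI.
apply: (@wspan_mul _ _ (Phi 1)) => // f fl; rewrite mulrC -{1}[f]mulr1; move: f fl 1.
apply: ps_indN => [c h|f g e1 e2 h|i f il e h].
- exact: additive_int.
- by rewrite !mulrDl FD e1 e2.
- by rewrite -!mulrA FX // e.
Qed.

(** Induction on the number of target variables that are not yet identified. When none is left,
    the source variables from x_l on form a single gap. Otherwise the map is cut into pieces,
    the gap of each piece is split off, and the components identify one more variable. *)
Theorem partial_hom_locspan b l a Phi : (b <= a)%N -> partial_hom l a b Phi ->
  locspan (l + b) (a - b) Phi.
Proof.
elim: b l a Phi => [|b IH] l a Phi ba [FD FI FX FM].
  (* compositions with at least one part act as zero: all the variables form a gap *)
  have kil g f : all (leq 1) g -> g != [::] -> Phi (qsymM l g a * f) = 0.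
    by move=> pg ng; rewrite FM //; case: g pg ng => // *; rewrite qsymM_0 mul0r.
  have [fam [famD famX famI] e] := gap_decomposition FD kil.
  rewrite addn0 subn0; exists 0%N; rewrite addn0 in FI.
  have SS u : u \in ballot_seqs a -> wspan l (0 + a) (fun f => fam u (gapT l a u f)).
    rewrite mem_ballot_seqs => /andP[_ bu]; apply: wspan_gapT; rewrite ?addn0 //.
    apply: frozen_wspan; split; rewrite ?addn0; [exact: famD|exact: famI| |].
      move=> i f il; apply: famX => h; rewrite insert_X il; exact: FX.
    move=> g f pg; case: g pg => [|c g] pg; first by rewrite !qsymM_nil !mul1r.
    by rewrite qsymM_0 !mul0r (additive0 (famD u)).
  by apply: (wspan_ext (wspan_sum SS)) => f _; rewrite expr0 mul1r e.
have [N N0 kl] := fat_kill FD FM.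
apply: (@locspan_raise _ _ _ N).
apply: (@locspan_ext _ _ (fun f => xprod l ^+ N *
   \sum_(p <- iota 0 a) Phi (x (l + p) ^+ N * qsymM (l + p.+1) (nseq b N) (a - p.+1) * f))); last first.
  move=> f; rewrite xprod_qsymM -mulrA -FM; last by rewrite all_nseq N0 orbT.
  rewrite -[nseq b.+1 N]/(N :: nseq b N).
  have -> : N :: nseq b N = rcons (nseq b N) N by elim: (b) => //= n ->.
  rewrite qsymM_rcons big_distrl /= (big_morph Phi FD (additive0 FD)).
  rewrite -(big_mkord xpredT (fun p =>
    Phi (x (l + p) ^+ N * qsymM (l + p.+1) (nseq b N) (a - p.+1) * f))).
  by rewrite /index_iota subn0.
apply: locspan_scale; first by apply: In_le (In_Xn _ (xprod_in l)); exact: leq_addr.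
apply: locspan_sum => p; rewrite mem_iota add0n => /= pa.
have ea : (a = p.+1 + (a - p.+1))%N by rewrite subnKC.
move: (a - p.+1)%N ea => m ea; subst a.
case: (ltnP m b) => [mb|bm].
  (* no room for b variables above x_(l+p): the piece is zero *)
  exists 0%N; apply: wspan_0 => f _; rewrite (@qsymM_gt _ _ (nseq b N)) ?size_nseq //.
  by rewrite mulr0 mul0r (additive0 FD) mulr0.
have PD : {morph piece l p m b N Phi : f g / f + g} by exact: pieceD.
have [fam [famD famX famI] e] := gap_decomposition PD (piece_gap N0 FD FM kl).
apply: (locspan_ext _ e); apply: locspan_sum => u; rewrite mem_ballot_seqs => /andP[_ bu].
have : partial_hom l.+1 m b (fam u).
  split.
  - exact: famD.
  - by move=> f; rewrite addSnnS; apply: famI => h; exact: FI.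
  - move=> i f; rewrite ltnS leq_eqVlt => /orP[/eqP->|il]; apply: famX => h.
      by rewrite insert_X ltnn; exact: (piece_X N0 FD FM kl).
    by rewrite insert_X il /piece mulrCA FX.
  - move=> g f pg; apply: famX => h; rewrite insert_qsymM // addSnnS.
    exact: (piece_tail N0 FD FM kl).
move/(IH _ _ _ bm) => [n SP]; rewrite addSnnS in SP; exists n.
have -> : (p.+1 + m - b.+1 = (m - b) + p)%N by lia.
by apply: wspan_gapT (SP) => //; lia.
Qed.
End Main.

(** * Words, integrality and uniqueness *)

(** The words whose successive operators T_i : Pol_m -> Pol_(m-1), starting from m = n with the
    last letter, all satisfy i < m - 1. *)
Fixpoint valid_word n (w : seq nat) : bool :=
  if w is i :: w' then (i + size w < n)%N && valid_word n w' else true.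

(** The weakly increasing word with given multiplicities. *)
Fixpoint word_of (u : seq nat) : seq nat :=
  if u is a :: u' then word_of u' ++ nseq a (size u') else [::].

Lemma size_word_of u : size (word_of u) = sumn u.
Proof. by elim: u => //= a u IH; rewrite size_cat IH size_nseq addnC. Qed.

Lemma valid_word_cat n w1 w2 : valid_word n (w1 ++ w2) = valid_word (n - size w2) w1 && valid_word n w2.
Proof.
elim: w1 => //= i w1 ->; rewrite size_cat andbA; congr (_ && _ && _).
by apply: (sameP idP); apply: (iffP idP); lia.
Qed.

Lemma valid_word_nseq n a s : valid_word n (nseq a s) = (a == 0%N) || (s + a < n)%N.
Proof.
elim: a => //= a ->; rewrite size_nseq; case: a => [|a] /=; first by rewrite andbT.
by apply: andb_idr; lia.
Qed.

Lemma valid_word_of n u : valid_word n (word_of u) = ballot n u.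
Proof.
elim: u n => //= a u IH n.
by rewrite valid_word_cat valid_word_nseq size_nseq IH andbC.
Qed.

Lemma valid_word_succn n w : valid_word n.+1 (map succn w) = valid_word n w.
Proof. by elim: w => //= i w ->; rewrite size_map addSn ltnS. Qed.

Lemma valid_word_rcons n w i : (i < n)%N -> valid_word n w -> valid_word n.+1 (rcons w i).
Proof.
move=> lt; elim: w => [|j w IH] /=; first by rewrite addn1 ltnS lt.
by case/andP=> h /IH->; rewrite size_rcons addnS ltnS h.
Qed.

Lemma sorted_word_of n w : sorted leq w -> all (gtn n) w -> exists2 u, size u = n & word_of u = w.
Proof.
elim: n w => [|n IHn] w; first by case: w => // _ _; exists [::].
elim/last_ind: w => [|w i IHw] srt bnd.
  by have [u su wu] := IHn [::] erefl erefl; exists (0%N :: u); rewrite /= ?su ?wu.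
move: bnd; rewrite all_rcons => /andP[/= iN bnd].
have srtw : sorted leq w by move: srt; rewrite -cats1 => /cat_sorted2[].
move: iN; rewrite ltnS leq_eqVlt => /orP[/eqP->|ltin].
  have [[//|a u] [su] wu] := IHw srtw bnd; exists (a.+1 :: u); first by rewrite /= su.
  by rewrite -wu /= su -cats1 -catA -(nseqD a 1) addn1.
have le w' : sorted leq (rcons w' i) -> all (geq i) w'.
  move=> s'; apply/allP => j jw; have := s'; rewrite (sorted_pairwise leq_trans).
  by rewrite pairwise_rcons => /andP[/allP/(_ j jw)].
have [|u su wu] := IHn (rcons w i) srt.
  rewrite all_rcons /= ltin; apply: sub_all (le _ srt) => j /= ji; exact: leq_ltn_trans ltin.
by exists (0%N :: u); rewrite /= ?su ?wu ?cats0.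
Qed.

Section Words.
Variable S : polySystem.
Local Notation A := (@psRing S).
Local Notation x := (@psX S).
Local Notation R := (@psR S).
Local Notation T := (@psT S).
Local Notation PN := (@psIn S).
Local Notation qsymM := (@qsymM S).
Local Notation xmon := (@xmon S).

Definition wordT w (f : A) : A := foldr (fun i => T i) f w.
Definition wordRT k w f := iter (k - size w) (R 0) (wordT w f).

Lemma wordT_word_of u f : wordT (word_of u) f = powT 0 u f.
Proof.
elim: u f => //= a u IH f; rewrite /wordT foldr_cat -/(wordT _ _) IH; congr powT.
by rewrite add0n; elim: a => //= a ->.
Qed.

Lemma wordT_R w f : wordT w (R 0 f) = R 0 (wordT (map succn w) f).
Proof. by elim: w => //= i w ->; rewrite R_T. Qed.

Lemma wordT_in n w f : valid_word n w -> f \in PN n -> wordT w f \in PN (n - size w).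
Proof.
elim: w => [|i w IH] /=; first by rewrite subn0.
case/andP=> h v fn; apply: T_in; first lia.
have -> : ((n - (size w).+1).+1 = n - size w)%N by lia.
exact: IH.
Qed.

Lemma wordRT_in n k w f : (k <= n)%N -> valid_word n w -> (size w <= k)%N -> f \in PN n ->
  wordRT k w f \in PN (n - k).
Proof.
move=> kn v wk fn; rewrite /wordRT; have := wordT_in v fn; move: (wordT w f) => g.
have -> : (n - size w = n - k + (k - size w))%N by lia.
elim: (k - size w)%N g => [|e IH] g; first by rewrite addn0.
by rewrite addnS iterSr => gn; apply: IH; exact: R_in.
Qed.

Lemma wordRT_additive k w : {morph wordRT k w : f g / f + g}.
Proof.
move=> f g; rewrite /wordRT.
have -> : wordT w (f + g) = wordT w f + wordT w g by elim: w => //= i w ->; rewrite raddfD.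
by elim: (_ - _)%N => // e IH; rewrite !iterS IH rmorphD.
Qed.

(** Moving each R_0 to the left past the T_i ([wordT_R]) puts words in the form
    R_0^(k-|w|) T_w. *)
Lemma wspan_words r k Phi : wspan r k Phi -> exists L : seq (A * seq nat),
  (forall p, p \in L -> [/\ p.1 \in PN r, valid_word (r + k) p.2 & (size p.2 <= k)%N]) /\
  (forall f, f \in PN (r + k) -> Phi f = \sum_(p <- L) p.1 * wordRT k p.2 f).
Proof.
elim=> {k Phi} [c Phi cr e|k Psi Phi SP [L [IL IH]] e|k i Psi Phi ik SP [L [IL IH]] e|k Phi e
  |k P1 P2 Phi _ [L1 [IL1 I1]] _ [L2 [IL2 I2]] e].
- exists [:: (c, [::])]; split; first by move=> p; rewrite inE => /eqP->.
  by move=> f; rewrite addn0 => fr; rewrite big_seq1 e.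
- exists [seq (p.1, map succn p.2) | p <- L]; split.
    move=> _ /mapP[[c w] /IL /= [cr v s] ->]; rewrite /= addnS valid_word_succn size_map.
    by split=> //; exact: leqW.
  move=> f; rewrite addnS => fn; rewrite e // IH; last exact: R_in.
  rewrite big_map; apply: eq_big_seq => -[c w] /IL /= [_ _ s]; congr (_ * _).
  by rewrite /wordRT wordT_R size_map subSn // iterSr.
- exists [seq (p.1, rcons p.2 i) | p <- L]; split.
    move=> _ /mapP[[c w] /IL /= [cr v s] ->]; rewrite /= addnS size_rcons.
    by split=> //; exact: valid_word_rcons.
  move=> f; rewrite addnS => fn; rewrite e // IH; last exact: T_in.
  rewrite big_map; apply: eq_big_seq => -[c w] _ /=; congr (_ * _).
  by rewrite /wordRT size_rcons subSS /wordT foldr_rcons.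
- by exists [::]; split => // f fn; rewrite big_nil e.
- exists (L1 ++ L2); split; first by move=> p; rewrite mem_cat => /orP[/IL1|/IL2].
  by move=> f fn; rewrite big_cat e // I1 // I2.
Qed.

Lemma iterR_R i j g : R i (iter j (R 0) g) = iter j (R 0) (R (i + j) g).
Proof.
elim: j i => [|j IH] i; first by rewrite addn0.
by rewrite !iterS RR // IH addSnnS.
Qed.

(** The iterates of R_0 on g form a stable family over a gap that consists of all the variables. *)
Lemma wordRT_equiv n k w g f : (k <= n)%N -> (exists2 u, ballot n u & w = word_of u) ->
  (size w <= k)%N -> (forall i, (i < n)%N -> R i g = R 0 g) ->
  wordRT k w (g * f) = iter k (R 0) g * wordRT k w f.
Proof.
move=> kn [u bu ->] wk gR; rewrite /wordRT !wordT_word_of.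
rewrite size_word_of in wk *.
pose c q := iter (n - q) (R 0) g.
have st : zero_stable 0 n c.
  move=> q i qn iq; rewrite /c add0n iterR_R gR; last by lia.
  by rewrite -iterSr (_ : (n - q.+1).+1 = n - q)%N //; lia.
have cn : c n = g by rewrite /c subnn.
rewrite -{1}cn (powT_cM _ st) // (iterR_cM _ st).
  by rewrite /c (_ : n - (n - sumn u - (k - sumn u)) = k)%N //; lia.
by apply/andP; split; lia.
Qed.

Lemma wordRT_xmon_id k u : wordRT k (word_of u) (xmon 0 u) = 1.
Proof. by rewrite /wordRT wordT_word_of powT_xmon_id iterR_1. Qed.

Lemma wordRT_xmon_lt k u v : size u = size v -> lexlt v u -> wordRT k (word_of u) (xmon 0 v) = 0.
Proof.
move=> e lt; rewrite /wordRT wordT_word_of powT_xmon_lt //.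
by elim: (_ - _)%N => // j IH; rewrite iterS IH rmorph0.
Qed.

(** Evaluating the combination at the monomials x^(U H), in increasing order, determines each
    coefficient from the lower ones, so that divisibility by d passes from the values to the
    coefficients. For d = 0 this is uniqueness. *)
Lemma triangular_div (I : eqType) (L : seq I) (U : I -> seq nat) n k r d (b t : I -> A) :
  (k <= n)%N -> r = (n - k)%N -> uniq L ->
  (forall H, H \in L -> [/\ size (U H) = n, ballot n (U H) & (sumn (U H) <= k)%N]) ->
  {in L &, injective U} ->
  (forall H, H \in L -> b H \in PN r) -> (forall H, H \in L -> t H \in PN r) ->
  (forall H, H \in L -> \sum_(G <- L) b G * wordRT k (word_of (U G)) (xmon 0 (U H)) = d * t H) ->
  forall H, H \in L -> exists2 c, c \in PN r & b H = d * c.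
Proof.
move=> kn er uL UP Uinj bP tP E.
suff K u : size u = n -> forall H, H \in L -> U H = u -> exists2 c, c \in PN r & b H = d * c.
  by move=> H HL; apply: (K (U H)) => //; case: (UP H HL).
move: u; apply: lexlt_ind => u su IH H HL eU.
have [_ balH sH] := UP H HL.
have := E H HL; rewrite (bigD1_seq H) //= wordRT_xmon_id mulr1 => /eqP.
rewrite eq_sym -subr_eq => /eqP <-.
suff [c cr ->] : exists2 c, c \in PN r &
    \sum_(G <- L | G != H) b G * wordRT k (word_of (U G)) (xmon 0 (U H)) = d * c.
  by exists (t H - c); [apply: In_B => //; exact: tP | rewrite mulrBr].
rewrite big_seq_cond; elim/big_ind: _ => [|f g [c cr ->] [c' cr' ->]|G /andP[GL GH]].
- by exists 0; rewrite ?mulr0 // In_0.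
- by exists (c + c'); [exact: In_D | rewrite mulrDr].
have [sG bG smG] := UP G GL.
have := @lexlt_total (U G) (U H); rewrite sG eU su => /(_ erefl) /or3P[lt|/eqP e|lt].
- have [c cr ->] := IH (U G) sG lt G GL erefl.
  exists (c * wordRT k (word_of (U G)) (xmon 0 u)); last by rewrite mulrA.
  apply: In_M => //; rewrite er; apply: wordRT_in; rewrite ?valid_word_of ?size_word_of //.
  by rewrite -su -[size u]add0n; exact: xmon_in.
- by move: GH; rewrite (Uinj G H) ?eqxx // e.
- by exists 0; [exact: In_0 | rewrite wordRT_xmon_lt ?mulr0 // sG].
Qed.

Lemma xprod_inj r N : injective ( *%R (xprod S r ^+ N)).
Proof.
elim: N => [|N IH] f g; first by rewrite expr0 !mul1r.
rewrite exprS -!mulrA => /= e; apply: IH; move: e; move: (_ * f) (_ * g).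
rewrite /xprod; elim: r => [|r IH] f' g'; first by rewrite big_ord0 !mul1r.
by rewrite big_ord_recr /= -!mulrA => /IH /psX_inj.
Qed.

(** Extends maps on Pol_n to the whole ring. *)
Definition truncate_vars n : {rmorphism A -> A} :=
  sval (psSubst (fun i => if (i < n)%N then x i else 0)).

Lemma truncate_X n i : truncate_vars n (x i) = if (i < n)%N then x i else 0.
Proof. by rewrite /truncate_vars; case: psSubst. Qed.

Lemma truncate_in n f : truncate_vars n f \in PN n.
Proof.
move: f; apply: ps_ind => [c|f g|i f]; rewrite ?rmorph_int ?In_int //.
  by rewrite rmorphD; exact: In_D.
rewrite rmorphM; apply: In_M; rewrite truncate_X.
by case: ifP => [|_]; [exact: psIn_X | exact: In_0].
Qed.

Lemma truncate_id n f : f \in PN n -> truncate_vars n f = f.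
Proof.
move: f; apply: ps_indN => [c|f g e1 e2|i f lt e]; rewrite ?rmorph_int //.
  by rewrite rmorphD e1 e2.
by rewrite rmorphM e truncate_X lt.
Qed.

(** The indexing by forests only matters through a function [cls] on words whose fibres are
    represented by sorted words, given by their exponents [U]. *)
Section Expansion.
Variables (I : choiceType) (n k : nat) (le_kn : (k <= n)%N).
Variables (cls : seq nat -> I) (U : I -> seq nat).
Hypothesis cls_exponents : forall w, valid_word n w ->
  [/\ size (U (cls w)) = n, ballot n (U (cls w)), sumn (U (cls w)) = size w,
      cls (word_of (U (cls w))) = cls w & forall f, wordRT k w f = wordRT k (word_of (U (cls w))) f].

Definition admissible H := exists w, [/\ H = cls w, valid_word n w & (size w <= k)%N].

Lemma admissible_exponents H : admissible H ->
  [/\ size (U H) = n, ballot n (U H) & (sumn (U H) <= k)%N].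
Proof. by case=> w [-> /cls_exponents[su bu mu _ _] wk]; rewrite mu. Qed.

Lemma admissible_inj (L : seq I) : (forall H, H \in L -> admissible H) -> {in L &, injective U}.
Proof.
move=> adm H H' /adm[w [-> /cls_exponents[_ _ _ e _] _]] /adm[w' [-> /cls_exponents[_ _ _ e' _] _]].
by move=> eU; rewrite -e eU e'.
Qed.

Lemma expansion_unique (L : seq I) (b : I -> A) : uniq L ->
  (forall H, H \in L -> admissible H) -> (forall H, H \in L -> b H \in PN (n - k)) ->
  (forall f, f \in PN n -> \sum_(H <- L) b H * wordRT k (word_of (U H)) f = 0) ->
  forall H, H \in L -> b H = 0.
Proof.
move=> uL adm bP E H HL.
have [|G GL|c _ ->] := @triangular_div I L U n k (n - k) 0 b (fun _ => 0) le_kn erefl uL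
  (fun H HL => admissible_exponents (adm H HL)) (admissible_inj adm) bP _ _ H HL.
- by move=> *; exact: In_0.
- rewrite mul0r E //; have [su _ _] := admissible_exponents (adm G GL).
  by have := xmon_in S 0 (U G); rewrite su.
- by rewrite mul0r.
Qed.

(** The coefficients found after localization are divided by the monomial with
    [triangular_div]: the values of Phi at the monomials x^(U H) are integral. *)
Theorem expansion Phi : partial_hom 0 n (n - k) Phi -> exists (L : seq I) (c : I -> A),
  [/\ uniq L, forall H, H \in L -> admissible H, forall H, H \in L -> c H \in PN (n - k)
    & forall f, f \in PN n -> Phi f = \sum_(H <- L) c H * wordRT k (word_of (U H)) f].
Proof.
move=> V; have [_ PhiI _ _] := V.
have := partial_hom_locspan (leq_subr k n) V; rewrite add0n subKn // => -[N /wspan_words[W [WP WE]]].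
rewrite subnK // in WP WE.
set r := (n - k)%N in V PhiI WP WE *.
pose L := undup [seq cls p.2 | p <- W].
have uL : uniq L by exact: undup_uniq.
have adm H : H \in L -> admissible H.
  by rewrite mem_undup => /mapP[p /WP[_ v s] ->]; exists p.2.
pose b H := \sum_(p <- W | cls p.2 == H) p.1.
have bP H : H \in L -> b H \in PN r.
  by move=> _; rewrite /b big_seq_cond; apply: In_sum => p /andP[/WP[]].
have DE f : f \in PN n -> xprod S r ^+ N * Phi f = \sum_(H <- L) b H * wordRT k (word_of (U H)) f.
  move=> fn; rewrite WE //.
  transitivity (\sum_(p <- W) \sum_(H <- L | H == cls p.2) p.1 * wordRT k (word_of (U H)) f).
    apply: eq_big_seq => p pW; rewrite -big_filter filter_pred1_uniq // ?big_seq1; last first.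
      by rewrite mem_undup; apply: map_f.
    by have [_ v _] := WP p pW; have [_ _ _ _ ->] := cls_exponents v.
  rewrite (exchange_big_dep xpredT) //=; apply: eq_bigr => H _.
  by rewrite /b big_distrl /=; apply: eq_bigl => p; rewrite eq_sym.
have mP H : H \in L -> xmon 0 (U H) \in PN n.
  by move=> /adm/admissible_exponents[su _ _]; have := xmon_in S 0 (U H); rewrite su.
have div := @triangular_div I L U n k r (xprod S r ^+ N) b (fun H => Phi (xmon 0 (U H))) le_kn erefl
  uL (fun H HL => admissible_exponents (adm H HL)) (admissible_inj adm) bP
  (fun H _ => PhiI _) (fun H HL => esym (DE _ (mP H HL))).
have exc H : exists c, (H \in L) ==> (c \in PN r) && (b H == xprod S r ^+ N * c).
  case: (boolP (H \in L)) => [/div[c cr e]|_]; last by exists 0.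
  by exists c; rewrite cr e eqxx.
have {exc}[c cP] : exists c : I -> A, forall H, H \in L ->
    c H \in PN r /\ b H = xprod S r ^+ N * c H.
  exists (fun H => xchoose (exc H)) => H HL.
  by have /implyP/(_ HL)/andP[cr /eqP e] := xchooseP (exc H); split.
exists L, c; split=> // [H /cP[]//|f fn]; apply: (@xprod_inj r N); rewrite /= DE // big_distrr.
by apply: eq_big_seq => H /cP[_ ->]; rewrite -mulrA.
Qed.
End Expansion.
End Words.

(** * The polynomial ring *)
Lemma malgC_int (c : int) : c%:MP = c%:~R :> Pol.
Proof. by rewrite -[c in LHS]intz (rmorph_int (@malgC {cmonom nat} int)). Qed.

Lemma malgU_split (c : int) (m : {cmonom nat}) j : m j != 0%N ->
  << c *g m >> = varX j * << c *g divcm m (ucm j) >> :> Pol.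
Proof. by move=> mj; rewrite malgM_def fgmulUU mul1r mulmC divcm_mulU. Qed.

Lemma mdeg_div (m : {cmonom nat}) j : m j != 0%N -> (mdeg (divcm m (ucm j)) < mdeg m)%N.
Proof. by move=> mj; rewrite -{2}(divcm_mulU mj) mdegM mdegU addn1. Qed.

Lemma pol_ind (P : Pol -> Prop) :
  (forall c, P c%:MP) -> (forall f g, P f -> P g -> P (f + g)) ->
  (forall i f, P f -> P (varX i * f)) -> forall f, P f.
Proof.
move=> PC PD PX.
have PU c (m : {cmonom nat}) : P << c *g m >>.
  have [N] := ubnP (mdeg m); elim: N m => // N IH m ltN.
  have [->|/cmonom_neq1 [j mj]] := eqVneq m mone; first exact: PC.
  rewrite (malgU_split _ mj); apply/PX/IH.
  by apply: leq_trans (mdeg_div mj) _; rewrite -ltnS.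
move=> f; rewrite [f]monalgE; elim/big_rec: _ => [|m g _ Pg].
  by rewrite -malgC0E; exact: PC.
exact: PD.
Qed.

Lemma pol_indN n (P : Pol -> Prop) :
  (forall c, P c%:MP) -> (forall f g, P f -> P g -> P (f + g)) ->
  (forall i f, (i < n)%N -> P f -> P (varX i * f)) ->
  forall f, f \in inPol n -> P f.
Proof.
move=> PC PD PX.
have PU c (m : {cmonom nat}) : (forall j, m j != 0%N -> (j < n)%N) -> P << c *g m >>.
  have [N] := ubnP (mdeg m); elim: N m => // N IH m ltN mn.
  have [->|/cmonom_neq1 [j mj]] := eqVneq m mone; first exact: PC.
  rewrite (malgU_split _ mj); apply/PX/IH; first exact: mn.
    by apply: leq_trans (mdeg_div mj) _; rewrite -ltnS.
  move=> i; rewrite divcmE -!lt0n subn_gt0 => H; apply: mn; rewrite -lt0n.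
  exact: leq_ltn_trans H.
move=> f /inPolP fn; rewrite [f]monalgE big_seq; elim/big_rec: _ => [|m g mf Pg].
  by rewrite -malgC0E; exact: PC.
by apply: PD => //; apply: PU => j; exact: fn.
Qed.

Lemma mulX_inj i : injective ( *%R (varX i) : Pol -> Pol).
Proof. by move=> f g e; rewrite -(divXK i f) e divXK. Qed.

Lemma R_lt i j : (j < i)%N -> opR i (varX j) = varX j.
Proof. by rewrite opR_X /R_var => ->. Qed.
Lemma R_eq i : opR i (varX i) = 0.
Proof. by rewrite opR_X /R_var ltnn eqxx. Qed.
Lemma R_ge i j : (i <= j)%N -> opR i (varX j.+1) = varX j.
Proof. by move=> le; rewrite opR_X /R_var ltnNge (leqW le) /= gtn_eqF. Qed.

Lemma divided_differenceB (V : comNzRingType) (y t u v a b a1 a2 b1 b2 : V) :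
  y * t = a - b -> a = a1 - a2 -> b = b1 - b2 -> y * u = a1 - b1 -> y * v = a2 - b2 ->
  y * t = y * (u - v).
Proof.
by move=> -> -> -> eu ev; rewrite mulrBr eu ev !opprB addrACA (addrC (- a2)) -addrACA.
Qed.

Lemma opT_is_zmod i : zmod_morphism (opT i).
Proof.
move=> f g; apply: (@mulX_inj i).
exact: (@divided_differenceB Pol _ _ _ _ _ _ _ _ _ _ (opTE i (f - g))
  (rmorphB (opR i.+1) f g) (rmorphB (opR i) f g) (opTE i f) (opTE i g)).
Qed.
HB.instance Definition _ i := GRing.isZmodMorphism.Build Pol Pol (opT i) (opT_is_zmod i).

Lemma inPol_X n i : (i < n)%N -> varX i \in inPol n.
Proof.
move=> lt; apply/inPolP => m j; rewrite /varX msuppU1 in_fset1 => /eqP->.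
by rewrite cmU; case: (i =P j) => // <-.
Qed.

Lemma inPol_X_div n i (f : Pol) : varX i * f \in inPol n -> f \in inPol n.
Proof.
move=> /inPolP H; apply/inPolP => m j.
rewrite -mcoeff_neq0 -(varX_mul_coef i) mcoeff_neq0 => /H Hj mj; apply: Hj.
by rewrite cmM addn_eq0 negb_and mj.
Qed.

Section Subst.
Variable phi : nat -> Pol.

Definition subst_mon (m : {cmonom nat}) : Pol := \prod_(j <- finsupp m) phi j ^+ m j.

Lemma subst_monEw (d : {fset nat}) (m : {cmonom nat}) :
  (finsupp m `<=` d)%fset -> subst_mon m = \prod_(j <- d) phi j ^+ m j.
Proof.
move=> le; rewrite /subst_mon.
apply: big_fset_incl => //= j jd jm.
by rewrite fsfun_dflt // expr0.
Qed.

Lemma subst_mon_mmorphism : mmorphism subst_mon.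
Proof.
split.
- move=> m1 m2; pose d := finsupp (mmul m1 m2).
  have le1 : (finsupp m1 `<=` d)%fset by rewrite /d mdomD fsubsetUl.
  have le2 : (finsupp m2 `<=` d)%fset by rewrite /d mdomD fsubsetUr.
  rewrite (subst_monEw le1) (subst_monEw le2) /subst_mon -big_split /=.
  by apply: eq_bigr => j _; rewrite cmM exprD.
- by rewrite /subst_mon mdom1 big_seq_fset0.
Qed.

HB.instance Definition _ :=
  isMultiplicative.Build {cmonom nat} Pol subst_mon subst_mon_mmorphism.

Lemma subst_exists : {h : {rmorphism Pol -> Pol} | forall i, h (varX i) = phi i}.
Proof.
exists (mmap (@malgC {cmonom nat} int) subst_mon) => i.
by rewrite /= /varX mmapU /= mpolyC1E mul1r /subst_mon mdomU big_seq_fset1 cmUU expr1.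
Qed.
End Subst.

Lemma pol_ind_int (P : Pol -> Prop) :
  (forall c : int, P c%:~R) -> (forall f g, P f -> P g -> P (f + g)) ->
  (forall i f, P f -> P (varX i * f)) -> forall f, P f.
Proof. by move=> PC; apply: pol_ind => c; rewrite malgC_int. Qed.

Lemma pol_indN_int n (P : Pol -> Prop) :
  (forall c : int, P c%:~R) -> (forall f g, P f -> P g -> P (f + g)) ->
  (forall i f, (i < n)%N -> P f -> P (varX i * f)) ->
  forall f, f \in inPol n -> P f.
Proof. by move=> PC; apply: pol_indN => c; rewrite malgC_int. Qed.

Definition Pol_system : polySystem :=
  @PolySystem (Pol : comNzRingType) varX (fun i => opR i) (fun i => opT i) inPol
    mulX_inj R_lt R_eq R_ge opTE subst_exists inPol_subring inPol_X inPol_X_div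
    pol_ind_int pol_indN_int.

(** * Forests and words *)
Lemma cherry_mulE i G j : forest_mul (cherry i) G j =
  if (j < i)%N then G j else if j == i then Node (G i) (G i.+1) else G j.+1.
Proof.
rewrite forest_mulE first_leaf_cherry /cherry fsfun_withE fsfun0E.
by case: (ltngtP j i) => [ji|ij|->] /=; rewrite ?addn0 ?addn1.
Qed.

(** Left cancellation: the two subtrees at the new root can be read off. *)
Lemma cherry_inj i : injective (forest_mul (cherry i)).
Proof.
move=> F G e; have E j : forest_mul (cherry i) F j = forest_mul (cherry i) G j by rewrite e.
apply/fsfunP => j; case: (ltnP j i) => [ji|]; first by have := E j; rewrite !cherry_mulE ji.
rewrite leq_eqVlt => /orP[/eqP<-|].
  by have := E i; rewrite !cherry_mulE ltnn eqxx => -[].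
rewrite leq_eqVlt => /orP[/eqP<-|].
  by have := E i; rewrite !cherry_mulE ltnn eqxx => -[].
case: j => // j; rewrite ltnS => ij.
by have := E j; rewrite !cherry_mulE ltnNge (ltnW ij) gtn_eqF.
Qed.

(** The relations of the monoid of forests, matching [TT]. *)
Lemma cherryC i j F : (j < i)%N ->
  forest_mul (cherry i) (forest_mul (cherry j) F) =
  forest_mul (cherry j) (forest_mul (cherry i.+1) F).
Proof.
move=> ji; apply/fsfunP => m; rewrite !cherry_mulE.
have [->|mi] := eqVneq m i; have [e|mj] := eqVneq m j;
  rewrite ?e ?ltnn ?eqxx ?eqSS; repeat case: ifP; rewrite //=; try lia.
Qed.

Lemma forest_size_cherry i F : forest_size (forest_mul (cherry i) F) = (forest_size F).+1.
Proof.
have [N hN] := forest_bound F.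
pose M := (i + N).+2.
have hM j : (M <= j)%N -> F j = Leaf by move=> le; apply: hN; rewrite /M in le; lia.
have hP j : (M.-1 <= j)%N -> forest_mul (cherry i) F j = Leaf.
  by rewrite /M => le; rewrite cherry_mulE !ifN -?leqNgt; [apply: hN|..]; lia.
have split1 (g : nat -> nat) : (\sum_(0 <= j < (i + N).+1) g j =
    \sum_(0 <= j < i) g j + (g i + \sum_(i <= j < i + N) g j.+1))%N.
  rewrite (big_cat_nat (n := i)) /=; [|lia|lia]; congr (_ + _)%N.
  by rewrite big_ltn ?big_add1 //; lia.
have split2 (g : nat -> nat) : (\sum_(0 <= j < (i + N).+2) g j =
    \sum_(0 <= j < i) g j + (g i + (g i.+1 + \sum_(i <= j < i + N) g j.+2)))%N.
  rewrite (big_cat_nat (n := i)) /=; [|lia|lia]; congr (_ + _)%N.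
  rewrite big_ltn; last lia; congr (_ + _)%N.
  by rewrite big_ltn ?big_add1 /= ?big_add1 //; lia.
rewrite (forest_sizeEw hP) (forest_sizeEw hM) split1 split2 cherry_mulE ltnn eqxx /=.
rewrite (@eq_big_nat _ _ _ 0 i _ (fun j => nodes (F j))); last first.
  by move=> j /andP[_ ji]; rewrite cherry_mulE ji.
rewrite (@eq_big_nat _ _ _ i (i + N) _ (fun j => nodes (F j.+2))); first by lia.
by move=> j /andP[ij _]; rewrite cherry_mulE !ifN //; lia.
Qed.

Lemma forest_size0 : forest_size forest0 = 0%N.
Proof. by rewrite /forest_size finsupp0 big_seq_fset0. Qed.

Lemma forest_size_word w : forest_size (forest_word w) = size w.
Proof. by elim: w => [|i w IH] /=; rewrite ?forest_size0 // forest_size_cherry IH. Qed.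

(** Two words for the same forest give the same operator, by induction on their common length. If
    their first letters i < j differ, then the j-th tree of the forest is not trivial either, so
    the cherry at j can be split off after the one at i, where it has index j + 1; both words then
    agree with words starting with i, j + 1 and j, i, which the relation exchanges. *)
Lemma forest_word_op w w' : forest_word w = forest_word w' ->
  forall f, opT_word w f = opT_word w' f.
Proof.
have [n] := ubnP (size w); elim: n w w' => // n IH w w' ltn e f.
have es : size w = size w' by rewrite -!forest_size_word e.
case: w w' e es ltn => [|i v] [|j v'] e es ltn; [by []|discriminate es|discriminate es|].
case: es => es; rewrite /= in e ltn.
rewrite -[opT_word _ f]/(opT i (opT_word v f)) -[RHS]/(opT j (opT_word v' f)).
wlog ij : i j v v' e es ltn / (i <= j)%N.
  case: (leqP i j) => [le|/ltnW le] H; first exact: H.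
  by apply/esym/H; rewrite -?es.
move: ij; rewrite leq_eqVlt => /orP[/eqP eij|ij].
  rewrite -eij in e *; congr opT; exact: (IH _ _ ltn (cherry_inj e)).
(* the tree rooted at j becomes the one at j + 1 once the cherry at i is removed *)
have vj : forest_word v j.+1 != Leaf.
  have := f_equal (fun F : forest => F j) e; rewrite !cherry_mulE ltnNge (ltnW ij) /= gtn_eqF //.
  by rewrite ltnn eqxx => ->.
have [G [eG _]] := forest_peel vj.
have [z /eqP ez] := forest_word_surj G.
have ev : forest_word v = forest_word (j.+1 :: z) by rewrite /= ez eG.
have of_size : size v = (size z).+1 by rewrite -forest_size_word ev forest_size_word.
have ev' : forest_word v' = forest_word (i :: z).
  by apply: (@cherry_inj j); rewrite -e ev; exact: (esym (cherryC _ ij)).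
rewrite (IH v _ ltn ev); rewrite es in ltn; rewrite (IH v' _ ltn ev').
exact: (esym (@TT Pol_system _ _ _ ij)).
Qed.

Lemma opT_forest_word w f : opT_forest (forest_word w) f = opT_word w f.
Proof.
by apply: forest_word_op; apply/eqP; exact: (xchooseP (forest_word_surj (forest_word w))).
Qed.

Lemma leavesE t : leaves t = (nodes t).+1.
Proof. by elim: t => //= l -> r ->; rewrite addSn addnS. Qed.

(** The first leaf of the i-th tree: each tree before it has one leaf more than it has nodes. *)
Lemma first_leafE F i : first_leaf F i = (i + \sum_(0 <= j < i) nodes (F j))%N.
Proof.
rewrite /first_leaf big_mkord (eq_bigr (fun j : 'I_i => nodes (F j) + 1)%N).
  by rewrite big_split /= sum1_card card_ord addnC.
by move=> j _; rewrite leavesE addn1.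
Qed.

Lemma in_For n F : F \in For_ n <->
  (forall j, F j != Leaf -> (first_leaf F j + nodes (F j) < n)%N).
Proof.
rewrite /For_ inE; split=> [/allP H j Fj|H].
  apply: H; apply/flatten_mapP; exists j; first by rewrite mem_finsupp.
  by rewrite mem_iota leq_addr leavesE ltn_add2l /=.
apply/allP => l /flatten_mapP[j]; rewrite mem_finsupp => /H lt.
by rewrite mem_iota leavesE addnS ltnS => /andP[_ le]; exact: leq_ltn_trans lt.
Qed.

(** The last leaf of the last nontrivial tree, the j-th one, has index j + |F|: the condition on
    leaves becomes one on roots. *)
Lemma in_For_roots n F : F \in For_ n <->
  (forall j, F j != Leaf -> (j + forest_size F < n)%N).
Proof.
have sub N j : (j < N)%N -> (forall i, (N <= i)%N -> F i = Leaf) ->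
    (\sum_(0 <= i < j) nodes (F i) + nodes (F j) <= forest_size F)%N.
  move=> jN hN; rewrite (forest_sizeEw hN) [leqRHS](big_cat_nat (n := j.+1)) //.
  rewrite [in leqRHS]big_nat_recr //.
  exact: leq_addr.
have [N hN] := forest_bound F.
rewrite in_For; split=> H j Fj; last first.
  apply: leq_ltn_trans (H j Fj); rewrite first_leafE -addnA leq_add2l.
  apply: (sub N) => //; rewrite ltnNge; apply/negP => /hN e; by rewrite e eqxx in Fj.
have jN : (j < N)%N by rewrite ltnNge; apply/negP => /hN e; rewrite e eqxx in Fj.
have exP : exists i, F i != Leaf by exists j.
have bnd i : F i != Leaf -> (i <= N)%N.
  by move=> Fi; rewrite leqNgt; apply/negP => /ltnW/hN e; rewrite e eqxx in Fi.
(* the leaf condition is sharpest at the last nontrivial tree *)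
case: (ex_maxnP exP bnd) => m Fm maxm.
have := H m Fm; rewrite first_leafE -addnA; apply: leq_ltn_trans.
apply: leq_add; first exact: maxm.
rewrite (@forest_sizeEw F m.+1) ?big_nat_recr // => i mi.
by apply/eqP/negP => /negP /maxm; rewrite leqNgt mi.
Qed.

(** Splitting off a cherry at i requires a root at i and leaves a forest of the same kind, which is
    the recursion of [valid_word]. *)
Lemma For_word n w : (forest_word w \in For_ n) = valid_word n w.
Proof.
elim: w n => [|i w IH] n.
  by apply/in_For => j; rewrite fsfun0E eqxx.
rewrite -[valid_word _ _]/((i + (size w).+1 < n)%N && valid_word n w) -IH.
apply/idP/andP => [/in_For_roots H|[lt /in_For_roots H]].
  have E j : forest_mul (cherry i) (forest_word w) j != Leaf -> (j + (size w).+1 < n)%N.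
    by move/H; rewrite -[(size w).+1]/(size (i :: w)) -forest_size_word.
  have lt : (i + (size w).+1 < n)%N by apply: E; rewrite cherry_mulE ltnn eqxx.
  split=> //; apply/in_For_roots => j Gj; rewrite forest_size_word.
  case: (leqP j i.+1) => [|ij]; first lia.
  have : (j.-1 + (size w).+1 < n)%N; last lia.
  by apply: E; rewrite cherry_mulE !ifN ?prednK //; lia.
apply/in_For_roots => j; rewrite forest_size_word /= cherry_mulE.
case: ifP => [ji _|ji]; first lia.
case: ifP => [/eqP-> _|ne /H] //.
by rewrite forest_size_word addSnnS.
Qed.

(** The first letter is the index of the leftmost nontrivial tree. *)
Lemma sorted_forest_word F : exists2 w, sorted leq w & forest_word w = F.
Proof.
suff [w [srt e _]] : exists w, [/\ sorted leq w, forest_word w = F &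
    forall i, (forall j, (j < i)%N -> F j = Leaf) -> all (leq i) w] by exists w.
have [n] := ubnP (forest_size F); elim: n F => // n IH F ltFn.
have [F0|/fset0Pn[i0]] := eqVneq (finsupp F) fset0.
  by exists [::]; split => //; apply/fsfunP => i; rewrite fsfun0E fsfun_dflt // F0.
rewrite mem_finsupp => Fi0.
case: (ex_minnP (ex_intro (fun i => F i != Leaf) i0 Fi0)) => i Fi mini.
have [G [eG ltG]] := forest_peel Fi.
have [w [srt e low]] := IH G (leq_trans ltG ltFn).
have Gi : all (leq i) w.
  apply: low => j ji; have := f_equal (fun F : forest => F j) eG; rewrite cherry_mulE ji => ->.
  by apply/eqP/negP => /negP/mini; rewrite leqNgt ji.
exists (i :: w); split; rewrite /= ?e ?eG //.
  by rewrite (path_sortedE leq_trans) Gi.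
move=> j lowj; have ji : (j <= i)%N by rewrite leqNgt; apply/negP => /lowj e'; rewrite e' eqxx in Fi.
by rewrite ji; apply: sub_all Gi => l; exact: leq_trans.
Qed.

Lemma valid_word_lt n w : valid_word n w -> all (gtn n) w.
Proof. by elim: w => //= i w IH /andP[lt /IH->]; rewrite andbT; lia. Qed.

Lemma For_exponents n H : H \in For_ n ->
  exists u, [/\ size u = n, ballot n u & forest_word (word_of u) = H].
Proof.
have [w srt <-] := sorted_forest_word H; rewrite For_word => v.
have [u su wu] := sorted_word_of srt (valid_word_lt v).
by exists u; rewrite -valid_word_of wu.
Qed.

Lemma opRT_word k w f : opRT k (forest_word w) f = wordRT (S := Pol_system) k w f.
Proof. by rewrite /opRT /wordRT forest_size_word opT_forest_word. Qed.

(** * Quasisymmetric polynomials through their coefficients *)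

(** The exponents shifted so as to leave an exponent 0 at place i. *)
Definition insert_zero i (m : {cmonom nat}) : {cmonom nat} :=
  [cmonom (if l == i then 0 else m (unbump i l)) | l in [fset bump i j | j in finsupp m]%fset]%M.

Lemma insert_zeroE i m l : insert_zero i m l = if l == i then 0%N else m (unbump i l).
Proof.
rewrite /insert_zero cmE fsfun_fun; case: ifP => // nin; case: eqVneq => // li.
apply/esym/fsfun_dflt; apply: contraFN nin => mi.
by apply/imfsetP; exists (unbump i l); rewrite ?unbumpK.
Qed.

Lemma insert_zero_bump i m j : insert_zero i m (bump i j) = m j.
Proof. by rewrite insert_zeroE eq_sym (negPf (neq_bump i j)) bumpK. Qed.

Lemma insert_zero_same i m : insert_zero i m i = 0%N.
Proof. by rewrite insert_zeroE eqxx. Qed.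

Lemma insert_zero_div i m j : insert_zero i (divcm m (ucm j)) = divcm (insert_zero i m) (ucm (bump i j)).
Proof.
apply/eqP/cmP => l; rewrite divcmE !insert_zeroE; case: eqVneq => // li.
rewrite divcmE !cmU; congr (_ - nat_of_bool _)%N; apply/eqP/eqP => [->|<-].
  by rewrite unbumpK.
by rewrite bumpK.
Qed.

Lemma varX_mul_mcoef j (f : Pol) m :
  (varX j * f)@_m = if m j == 0%N then 0 else f@_(divcm m (ucm j)).
Proof.
case: ifPn => [/eqP mj|mj]; last by rewrite -{1}(divcm_mulU mj) varX_mul_coef.
apply/eqP; rewrite mcoeff_eq0; apply/negP => /msuppM_le[m1 [m2 [m1s _ e]]].
move: m1s; rewrite /varX msuppU1 in_fset1 => /eqP e1.
by rewrite e e1 cmM cmUU in mj.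
Qed.

(** R_i keeps the monomials without x_i and renumbers their variables. *)
Lemma opR_coef i (f : Pol) m : (opR i f)@_m = f@_(insert_zero i m).
Proof.
elim/pol_ind: f m => [c|f g ef eg|j f ef] m.
- rewrite opR_C !mcoeffC; congr (_ *+ nat_of_bool _).
  apply/eqP/eqP => [->|e]; apply/eqP/cmP => l; rewrite cm1.
    by rewrite insert_zeroE cm1 if_same.
  by rewrite -(insert_zero_bump i) e cm1.
- by rewrite (rmorphD (opR i) f g) !mcoeffD ef eg.
rewrite (rmorphM (opR i) (varX j) f) /= varX_mul_mcoef.
have [->|ji] := eqVneq j i.
  by rewrite insert_zero_same eqxx R_eq mul0r mcoeff0.
rewrite -(unbumpK (ji : j \in predC1 i)); move: (unbump i j) => {ji}j.
have -> : opR i (varX (bump i j)) = varX j.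
  by rewrite /bump; case: leqP => le; [rewrite add1n R_ge | rewrite add0n R_lt].
by rewrite varX_mul_mcoef insert_zero_bump ef insert_zero_div.
Qed.

Lemma expcmnE (m : {cmonom nat}) n l : expcmn m n l = (n * m l)%N.
Proof.
case: n => [|n]; first by rewrite /expcmn /= onecmE.
rewrite /expcmn iteropS; elim: n => [|n IH]; first by rewrite mul1n.
by rewrite iterS mulcmE IH -mulSn.
Qed.

Lemma mon_of_cons i s c a : mon_of (i :: s) (c :: a) = mmul (expcmn (ucm i) c) (mon_of s a).
Proof. by rewrite /mon_of /= big_cons. Qed.

Lemma insert_zero_mon_of i s a : insert_zero i (mon_of s a) = mon_of (map (bump i) s) a.
Proof.
have one (m : {cmonom nat}) : m = mone -> insert_zero i m = mone.
  by move=> ->; apply/eqP/cmP => l; rewrite insert_zeroE !cm1 if_same.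
elim: s a => [|j s IH] [|c a]; try by rewrite one /mon_of ?big_nil //= big_nil.
rewrite /= !mon_of_cons -IH; apply/eqP/cmP => l; rewrite cmM !insert_zeroE !cmM !expcmnE !cmU.
have [->|li] := eqVneq l i; first by rewrite [bump i j == i]eq_sym (negPf (neq_bump i j)) muln0.
rewrite (_ : (bump i j == l) = (j == unbump i l)) //.
by apply/eqP/eqP => [<-|->]; rewrite ?bumpK ?unbumpK.
Qed.

(** Every monomial has the form used in the definition of quasisymmetry. *)
Lemma mon_of_support (m : {cmonom nat}) s : uniq s -> {subset finsupp m <= s} ->
  mon_of s (map m s) = m.
Proof.
move=> us sub; apply/eqP/cmP => l.
have -> : mon_of s (map m s) l = if l \in s then m l else 0%N.
  elim: s us {sub} => [|j s IH] /=; first by rewrite /mon_of big_nil cm1.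
  case/andP=> js us; rewrite mon_of_cons cmM expcmnE cmU IH // in_cons (eq_sym l).
  by case: eqVneq => [<-|_] /=; rewrite ?muln1 ?muln0 ?(negPf js) ?addn0.
by case: ifPn => // /(contra (sub l)) ls; rewrite fsfun_dflt.
Qed.

(** By [opR_coef], the coefficients of R_i g and R_0 g at a monomial are those of g at two
    monomials with the same sequence of exponents, unless both involve a variable beyond the
    first n. *)
Lemma qsym_opR n (g : PolN n) i : is_qsym g -> (i < n)%N -> opR i g = opR 0 g.
Proof.
move=> Hq ilt; apply/malgP => m; rewrite !opR_coef.
case: (boolP (all (fun j => j.+1 < n)%N (finsupp m))) => [|/allPn[j jm]]; last first.
  rewrite -leqNgt => nj.
  have z i' : (i' < n)%N -> (g : Pol)@_(insert_zero i' m) = 0.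
    move=> i'n; apply/eqP; rewrite mcoeff_eq0; apply/negP => /(inPolP _ _ (valP g)) H.
    have := H (bump i' j); rewrite insert_zero_bump cmE_neq0 => /(_ jm).
    by rewrite /bump (_ : (i' <= j)%N = true); lia.
  by rewrite !z //; apply: leq_trans ilt.
move/allP=> mn; pose s := sort leq (finsupp m).
have us : uniq s by rewrite sort_uniq fset_uniq.
have srt : sorted ltn s by rewrite ltn_sorted_uniq_leq us sort_sorted //; exact: leq_total.
have ms : mon_of s (map m s) = m.
  by apply: mon_of_support => // j; rewrite mem_sort.
rewrite -ms !insert_zero_mon_of; apply: Hq; rewrite ?size_map //.
- by apply/allP => _ /mapP[j + ->]; rewrite mem_sort -cmE_neq0 lt0n.
- apply: homo_sorted srt => a b; rewrite /bump; lia.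
- by apply/allP => _ /mapP[j + ->]; rewrite mem_sort => /mn /=; rewrite /bump; lia.
- apply: homo_sorted srt => a b; rewrite /bump; lia.
- by apply/allP => _ /mapP[j + ->]; rewrite mem_sort => /mn /=; rewrite /bump; lia.
Qed.

Lemma sorted_full n s : sorted ltn s -> all (gtn n) s -> (n <= size s)%N -> s = iota 0 n.
Proof.
move=> srt bnd of_size.
have us : uniq s by move: srt; rewrite ltn_sorted_uniq_leq => /andP[].
have sub : {subset s <= iota 0 n} by move=> j /(allP bnd) /=; rewrite mem_iota add0n.
have [|_ e] := uniq_min_size us sub; first by rewrite size_iota.
exact: (irr_sorted_eq ltn_trans ltnn srt (iota_ltn_sorted 0 n) e).
Qed.

(** Conversely, if the R_i agree on f, then a variable x_i that is absent from a monomial can be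
    removed by R_i, that is, by R_0, and the result does not depend on the place i. Continue until
    all the variables occur. *)
Lemma opR_qsym n (f : Pol) : f \in inPol n -> (forall i, (i < n)%N -> opR i f = opR 0 f) ->
  forall a s t : seq nat, size s = size a -> sorted ltn s -> all (gtn n) s ->
    size t = size a -> sorted ltn t -> all (gtn n) t -> f@_(mon_of s a) = f@_(mon_of t a).
Proof.
elim: n f => [|n IH] f fn Rf a s t es srts bs et srtt bt.
  by rewrite (@sorted_full 0 s) // (@sorted_full 0 t).
case: (leqP n.+1 (size a)) => lt.
  by rewrite (@sorted_full n.+1 s) ?es // (@sorted_full n.+1 t) ?et.
have red u : size u = size a -> sorted ltn u -> all (gtn n.+1) u ->
    exists u', [/\ size u' = size a, sorted ltn u', all (gtn n) u' &
      f@_(mon_of u a) = (opR 0 f)@_(mon_of u' a)].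
  move=> eu srt bnd.
  have [i lti iu] : exists2 i, (i < n.+1)%N & i \notin u.
    have [i] : exists2 i, i \in iota 0 n.+1 & i \notin u.
      apply/allPn; apply: contraTN lt => /allP sub; rewrite -leqNgt -eu -(size_iota 0 n.+1).
      exact: uniq_leq_size (iota_uniq _ _) sub.
    by rewrite mem_iota add0n => lti iu; exists i.
  exists (map (unbump i) u); split.
  - by rewrite size_map.
  - have nu : all (predC1 i) u by apply/allP => j ju; apply: contraNneq iu => <-.
    apply: (homo_sorted_in _ nu srt) => j l; rewrite !inE /unbump => ji li; lia.
  - apply/allP => _ /mapP[j ju ->]; have /= := allP bnd _ ju.
    have : j != i by apply: contraNneq iu => <-.
    by rewrite /unbump; lia.
  - rewrite -(Rf i lti) opR_coef insert_zero_mon_of -map_comp (_ : map _ u = u) //.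
    apply: map_id_in => j ju /=; rewrite unbumpK //.
    by apply: contraNneq iu => <-.
have [s' [es' srts' bs' ->]] := red s es srts bs.
have [t' [et' srtt' bt' ->]] := red t et srtt bt.
apply: IH => //; first exact: (@R_in Pol_system n 0 f).
move=> i lti; rewrite (@RR Pol_system 0 i f) // -[LHS]/(opR 0 (opR i.+1 f)) Rf //.
Qed.

Lemma polN_val0 n : (0 : PolN n) = 0 :> Pol.
Proof. by []. Qed.

(** * The theorem *)
Lemma big_mulrBl_eq0 (V : comNzRingType) (I : Type) (s : seq I) (a b z : I -> V) :
  \sum_(i <- s) a i * z i = \sum_(i <- s) b i * z i -> \sum_(i <- s) (a i - b i) * z i = 0.
Proof.
move=> e; rewrite (eq_bigr (fun i => a i * z i - b i * z i)) => [|i _]; last exact: mulrBl.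
by rewrite sumrB e subrr.
Qed.

Lemma exponents_exist n H : exists u, (H \in For_ n) ==>
  [&& size u == n, ballot n u & forest_word (word_of u) == H].
Proof.
case: (boolP (H \in For_ n)) => [/For_exponents[u [su bu e]]|_]; last by exists [::].
by exists u; rewrite su bu e !eqxx.
Qed.

(** The exponent sequence of the sorted word of a forest in For_n. *)
Definition exponents n H := xchoose (exponents_exist n H).

Lemma exponentsP n H : H \in For_ n ->
  [/\ size (exponents n H) = n, ballot n (exponents n H) & forest_word (word_of (exponents n H)) = H].
Proof.
by move=> Hn; have /implyP/(_ Hn)/and3P[/eqP ? ? /eqP ?] := xchooseP (exponents_exist n H).
Qed.

Lemma opRT_exponents n k H f : H \in For_ n ->
  opRT k H f = wordRT (S := Pol_system) k (word_of (exponents n H)) f.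
Proof. by case/exponentsP=> _ _ {1}<-; rewrite opRT_word. Qed.

Lemma forest_word_exponents n k w : valid_word n w ->
  [/\ size (exponents n (forest_word w)) = n, ballot n (exponents n (forest_word w)),
      sumn (exponents n (forest_word w)) = size w,
      forest_word (word_of (exponents n (forest_word w))) = forest_word w
    & forall f, wordRT (S := Pol_system) k w f =
        wordRT (S := Pol_system) k (word_of (exponents n (forest_word w))) f].
Proof.
move=> v; have Hn : forest_word w \in For_ n by rewrite For_word.
have [su bu e] := exponentsP Hn; split=> //.
  by rewrite -size_word_of -forest_size_word e forest_size_word.
by move=> f; rewrite -opRT_exponents // opRT_word.
Qed.

Lemma opRT_hom n k H : (k <= n)%N -> H \in For_ n -> (forest_size H <= k)%N ->
  exists Phi : PolN n -> PolN (n - k),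
    is_qsym_hom Phi /\ forall f : PolN n, Phi f = opRT k H f :> Pol.
Proof.
move=> kn Hn Hk; have [su bu e] := exponentsP Hn.
set u := exponents n H in su bu e.
have sk : (size (word_of u) <= k)%N by rewrite -forest_size_word e.
have inP (f : PolN n) : opRT k H f \in inPol (n - k).
  rewrite (opRT_exponents _ _ Hn).
  by apply: (@wordRT_in Pol_system n k) => //; [rewrite valid_word_of | exact: valP].
exists (fun f => MkPolN (inP f)); split; last by [].
split=> [f g|g f gq]; last first.
  rewrite /= !(opRT_exponents _ _ Hn).
  apply: (@wordRT_equiv Pol_system n k) => //; first by exists u.
  by move=> i lt; exact: qsym_opR.
apply: val_inj; rewrite /= !(opRT_exponents _ _ Hn).
exact: (@wordRT_additive Pol_system).
Qed.

(** These are the quasisymmetric polynomials to which the linearity of a homomorphism is applied. *)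
Lemma qsymM_qsym n g (F : PolN n) : all (leq 1) g -> (F : Pol) = qsymM Pol_system 0 g n -> is_qsym F.
Proof.
move=> pg eF a s t _; apply: opR_qsym; first exact: valP.
case: n F eF => // n F -> i ltn.
transitivity (qsymM Pol_system 0 g n).
  exact: (@qsymM_R Pol_system 0 g n i pg ltn).
exact: (esym (@qsymM_R Pol_system 0 g n 0 pg (leq0n _))).
Qed.

Lemma iter_opR_qsymM g n k : all (leq 1) g -> (k <= n)%N ->
  iter k (opR 0) (qsymM Pol_system 0 g n) = qsymM Pol_system 0 g (n - k).
Proof.
move=> pg; elim: k => [|k IH] lt; first by rewrite subn0.
rewrite iterS IH; last exact: ltnW.
rewrite (_ : n - k = (n - k.+1).+1)%N; last lia.
exact: (@qsymM_R Pol_system 0 g (n - k.+1) 0 pg (leq0n _)).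
Qed.

Section Extend.
Variables (n k : nat) (le_kn : (k <= n)%N) (Phi : PolN n -> PolN (n - k)).
Hypothesis PhiP : is_qsym_hom Phi.

Definition extend_hom (f : Pol) : Pol := Phi (MkPolN (@truncate_in Pol_system n f)).

Lemma extend_homE (f : PolN n) : extend_hom f = Phi f.
Proof.
rewrite /extend_hom; congr (polN_val (Phi _)); apply: val_inj.
exact: (@truncate_id Pol_system n f (valP f)).
Qed.

Lemma extend_partial_hom : @partial_hom Pol_system 0 n (n - k) extend_hom.
Proof.
case: PhiP => PD PM; split.
- move=> f g; rewrite /extend_hom.
  rewrite (_ : MkPolN _ = MkPolN (@truncate_in Pol_system n f) + MkPolN (@truncate_in Pol_system n g)).
    by rewrite PD.
  by apply: val_inj; exact: (rmorphD (truncate_vars Pol_system n)).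
- by move=> f; exact: valP.
- by [].
move=> g f pg; rewrite /extend_hom.
have gin : qsymM Pol_system 0 g n \in inPol n by exact: (@qsymM_in Pol_system 0 g n).
rewrite (_ : MkPolN _ = MkPolN gin * MkPolN (@truncate_in Pol_system n f)); last first.
  apply: val_inj; rewrite -[LHS]/(truncate_vars Pol_system n (qsymM Pol_system 0 g n * f)).
  rewrite (rmorphM (truncate_vars Pol_system n)).
  by rewrite (@truncate_id Pol_system n _ gin).
rewrite PM; first by rewrite iter_opR_qsymM.
exact: (@qsymM_qsym n g (MkPolN gin) pg erefl).
Qed.
End Extend.

Theorem theorem11p2 (n k : nat) (le_kn : (k <= n)%N) :
  (forall H : forest, H \in For_ n -> (forest_size H <= k)%N ->
     exists Phi : PolN n -> PolN (n - k),
       is_qsym_hom Phi /\ forall f : PolN n, Phi f = opRT k H f :> Pol)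
  /\
  (forall Phi : PolN n -> PolN (n - k), is_qsym_hom Phi ->
     exists! c : {fsfun forest -> PolN (n - k) with 0},
       (forall H : forest, H \in finsupp c ->
          H \in For_ n /\ (forest_size H <= k)%N) /\
       forall f : PolN n,
         Phi f = \sum_(H <- finsupp c) (c H : Pol) * opRT k H f :> Pol).
Proof.
split=> [H|Phi PhiP]; first exact: opRT_hom.
have spec := @forest_word_exponents n k.
have adm H : admissible n k forest_word H <-> H \in For_ n /\ (forest_size H <= k)%N.
  split=> [[w [-> v wk]]|[Hn Hk]]; first by rewrite For_word v forest_size_word.
  have [su bu e] := exponentsP Hn; exists (word_of (exponents n H)).
  by rewrite e valid_word_of bu -forest_size_word e.
(* sums over the support of a coefficient function may be taken over any larger list *)
have wider (c : {fsfun forest -> PolN (n - k) with 0}) (L : seq forest) (f : PolN n) :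
    uniq L -> {subset finsupp c <= L} -> (forall H, H \in L -> H \in For_ n) ->
    \sum_(H <- finsupp c) (c H : Pol) * opRT k H f =
    \sum_(H <- L) (c H : Pol) * wordRT (S := Pol_system) k (word_of (exponents n H)) f.
  move=> uL sub Ln; rewrite [RHS](bigID (fun H => H \in finsupp c)) /=.
  rewrite [X in _ + X]big1 ?addr0; last first.
    by move=> H /fsfun_dflt->; rewrite polN_val0 mul0r.
  rewrite -[RHS]big_filter [RHS](perm_big (finsupp c)) /=.
    by apply: eq_big_seq => H /sub/Ln Hn; rewrite -opRT_exponents.
  apply: uniq_perm; rewrite ?filter_uniq ?fset_uniq // => H; rewrite mem_filter.
  by apply: andb_idr; exact: sub.
have [L [c [uL Ladm cP E]]] := @expansion Pol_system forest n k le_kn forest_word (exponents n) spec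
  (extend_hom Phi) (extend_partial_hom le_kn PhiP).
have Lok H : H \in L -> H \in For_ n /\ (forest_size H <= k)%N by move/Ladm/adm.
pose d : {fsfun forest -> PolN (n - k) with 0} :=
  [fsfun H in [fset H in L]%fset => insubd (0 : PolN (n - k)) (c H)].
have dE H : H \in L -> (d H : Pol) = c H.
  move=> HL; rewrite /d fsfun_fun in_fset /= HL -[LHS]/(val (insubd 0 (c H))) val_insubd.
  by rewrite ifT //; exact: cP.
have dsub H : H \in finsupp d -> H \in L.
  by rewrite mem_finsupp /d fsfun_fun in_fset /=; case: ifP; rewrite ?eqxx.
have dexp (f : PolN n) : Phi f = \sum_(H <- finsupp d) (d H : Pol) * opRT k H f :> Pol.
  rewrite (wider d L f uL dsub) => [|H /Lok[]//]; rewrite -extend_homE (E f (valP f)).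
  by apply: eq_big_seq => H HL; rewrite dE.
exists d; split; first by split=> // H /dsub/Lok.
move=> d' [d'ok d'exp].
(* compare the two expansions on the union of their supports *)
pose L' := undup (L ++ finsupp d').
have uL' : uniq L' by exact: undup_uniq.
have L'ok H : H \in L' -> H \in For_ n /\ (forest_size H <= k)%N.
  by rewrite mem_undup mem_cat => /orP[/Lok|/d'ok].
have zero := @expansion_unique Pol_system forest n k le_kn forest_word (exponents n) spec L'
  (fun H => (d H : Pol) - (d' H : Pol)) uL' (fun H HL => (adm H).2 (L'ok H HL)).
apply/fsfunP => H; apply: val_inj.
case: (boolP (H \in L')) => [HL|]; last first.
  rewrite mem_undup mem_cat negb_or => /andP[nL nd].
  by rewrite (fsfun_dflt nd) fsfun_dflt //; apply: contra nL; exact: dsub.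
apply/eqP; rewrite -subr_eq0; apply/eqP; apply: zero HL => [G _|f fn].
  by apply: (@In_B Pol_system); exact: valP.
have sub' : {subset finsupp d' <= L'} by move=> G Gd'; rewrite mem_undup mem_cat Gd' orbT.
have sub : {subset finsupp d <= L'} by move=> G /dsub GL; rewrite mem_undup mem_cat GL.
have L'n G : G \in L' -> G \in For_ n by case/L'ok.
have e : Phi (MkPolN fn) = \sum_(G <- L')
    (d G : Pol) * wordRT (S := Pol_system) k (word_of (exponents n G)) f :> Pol.
  rewrite dexp; exact: (wider d L' (MkPolN fn) uL' sub L'n).
have e' : Phi (MkPolN fn) = \sum_(G <- L')
    (d' G : Pol) * wordRT (S := Pol_system) k (word_of (exponents n G)) f :> Pol.
  rewrite d'exp; exact: (wider d' L' (MkPolN fn) uL' sub' L'n).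
exact: (@big_mulrBl_eq0 Pol _ _ _ _ _ (etrans (esym e) e')).
Qed.
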